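(* Let $n\ge2$ and let $\left((p^0_j,v^0_j)\right)_{j\in\mathbb{Z}}\subset\mathbb{R}^n\times S^{n-1}$ be initial data with $p^0_j\neq p^0_{j+1}$ for all $j$ and $\sup_j\|p^0_{j+1}-p^0_j\|<\infty$. If $$\sigma^{(0)}=\sup_{j\in\mathbb{Z}}\sigma\left((p^0_j,v^0_j),(p^0_{j+1},v^0_{j+1})\right)\le\frac{3\pi}{4},$$ then the IHB-scheme (interpolatory Hermite–Bézier subdivision scheme) applied to these data is $G^1$ convergent.
   Context: $\mathbb{R}^n$ carries the Euclidean inner product $\langle\cdot,\cdot\rangle$ and norm $\|\cdot\|$; $S^{n-1}$ is the unit sphere with the angular metric $g(v,w)=\arccos\langle v,w\rangle$. For $(p_0,v_0),(p_1,v_1)\in\mathbb{R}^n\times S^{n-1}$ with $p_0\ne p_1$ put $u=\frac{p_1-p_0}{\|p_1-p_0\|}$, $\theta_j=\arccos\langle v_j,u\rangle\in[0,\pi]$ ($j=0,1$), and $\sigma\left((p_0,v_0),(p_1,v_1)\right)=\sqrt{\theta_0^2+\theta_1^2}$. Bézier average with weight $\frac12$ (for $p_0\neq p_1$, $\theta_0+\theta_1<2\pi$): put $\alpha=\frac{\|p_1-p_0\|}{3\cos^2((\theta_0+\theta_1)/4)}$ and let $b$ be the cubic Bézier curve on $[0,1]$ with control points $p_0,\,p_0+\alpha v_0,\,p_1-\alpha v_1,\,p_1$, i.e. $b(t)=(1-t)^3p_0+3t(1-t)^2(p_0+\alpha v_0)+3t^2(1-t)(p_1-\alpha v_1)+t^3p_1$.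 Then $B_{1/2}\left((p_0,v_0),(p_1,v_1)\right)=\left(b(\tfrac12),\,b'(\tfrac12)/\|b'(\tfrac12)\|\right)$. IHB-scheme: for $k=0,1,2,\dots$ and $j\in\mathbb{Z}$, $$(p^{k+1}_{2j},v^{k+1}_{2j})=(p^k_j,v^k_j),\qquad (p^{k+1}_{2j+1},v^{k+1}_{2j+1})=B_{1/2}\left((p^k_j,v^k_j),(p^k_{j+1},v^k_{j+1})\right).$$ $G^1$ convergence means: (i) the piecewise linear interpolants $f_k:\mathbb{R}\to\mathbb{R}^n$ with $f_k(2^{-k}j)=p^k_j$ converge uniformly on $\mathbb{R}$ to a limit curve $\gamma$; (ii) the piecewise geodesic interpolants $PG_k:\mathbb{R}\to S^{n-1}$, $PG_k(t)=M_{t2^k-j}(v^k_j,v^k_{j+1})$ for $t\in[2^{-k}j,2^{-k}(j+1))$, where $M_\omega(v,w)$ is the point at angular distance $\omega\, g(v,w)$ from $v$ on the minimal great-circle arc from $v$ to $w$ ($v,w$ non-antipodal), which are considered for all sufficiently large $k$, converge uniformly to a continuous limit $\nu:\mathbb{R}\to S^{n-1}$; (iii) the limit tangents are tangent to the limit curve: for every $t$, $\frac{\gamma(s)-\gamma(t)}{\|\gamma(s)-\gamma(t)\|}\to\nu(t)$ as $s\to t^+$ and $\frac{\gamma(t)-\gamma(s)}{\|\gamma(t)-\gamma(s)\|}\to\nu(t)$ as $s\to t^-$. *)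

(* Defs.v *)
From mathcomp Require Export all_boot all_order all_algebra.
From mathcomp Require Export all_classical all_reals all_analysis.
Export Order.TTheory GRing.Theory Num.Theory numFieldNormedType.Exports.

Set Implicit Arguments.
Unset Strict Implicit.
Unset Printing Implicit Defensive.

Local Open Scope classical_set_scope.
Local Open Scope ring_scope.

Section HermiteBezier.
Context {R : realType} {n : nat}.
Implicit Types (u v w x p : 'rV[R]_n) (c d : 'rV[R]_n * 'rV[R]_n) (t s : R).

Definition dot v w : R := \sum_(i < n) v 0 i * w 0 i.

(* The library norm on ['rV[R]_n] is the sup norm; it is used below only
   through the topology that it shares with this one. *)
Definition enorm v : R := Num.sqrt (dot v v).

Definition sphere : set 'rV[R]_n := [set v | enorm v = 1].

Definition angle v w : R := acos (dot v w).

(* [normalize 0 = 0] *)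
Definition normalize v : 'rV[R]_n := (enorm v)^-1 *: v.

(* Hermite data are pairs (point, unit tangent). *)

Definition theta0 c d : R := angle c.2 (normalize (d.1 - c.1)).
Definition theta1 c d : R := angle d.2 (normalize (d.1 - c.1)).

Definition sigma c d : R := Num.sqrt (theta0 c d ^+ 2 + theta1 c d ^+ 2).

Definition bezier3 p0 p1 p2 p3 t : 'rV[R]_n :=
  (1 - t) ^+ 3 *: p0 + (3 * t * (1 - t) ^+ 2) *: p1
  + (3 * t ^+ 2 * (1 - t)) *: p2 + t ^+ 3 *: p3.

Definition average_dom c d : Prop :=
  c.1 <> d.1 /\ theta0 c d + theta1 c d < 2 * pi.

Definition average_alpha c d : R :=
  enorm (d.1 - c.1) / (3 * cos ((theta0 c d + theta1 c d) / 4) ^+ 2).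

Definition average_curve c d : R -> 'rV[R]_n :=
  let a := average_alpha c d in
  bezier3 c.1 (c.1 + a *: c.2) (d.1 - a *: d.2) d.1.

(* Meaningful only on [average_dom]. *)
Definition average c d : 'rV[R]_n * 'rV[R]_n :=
  (average_curve c d (1 / 2), normalize (derive1 (average_curve c d) (1 / 2))).

(* [%/] on [int] rounds towards -oo, so [i = 2 * (i %/ 2) + 1] for odd [i]. *)
Definition IHB_step (h : int -> 'rV[R]_n * 'rV[R]_n) (i : int) :=
  let j := (i %/ 2)%Z in
  if (2 %| i)%Z then h j else average (h j) (h (j + 1)).

Definition IHB (h : int -> 'rV[R]_n * 'rV[R]_n) (k : nat) :=
  iter k IHB_step h.

(* All averages taken by the scheme are defined. *)
Definition IHB_defined (h : int -> 'rV[R]_n * 'rV[R]_n) : Prop :=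
  forall (k : nat) (j : int), average_dom (IHB h k j) (IHB h k (j + 1)).

Definition minimal_arc v w : set 'rV[R]_n :=
  [set x | sphere x /\
     exists a b : R, [/\ 0 <= a, 0 <= b & x = a *: v + b *: w]].

(* For non-antipodal [v], [w] on the sphere and [0 <= om <= 1] exactly one
   point has this property; the default [v] is irrelevant. *)
Definition geodesic_point (om : R) v w : 'rV[R]_n :=
  xget v [set x | minimal_arc v w x /\ angle v x = om * angle v w].

Definition grid_index (k : nat) t : int := Num.floor (2 ^+ k * t).
Definition grid_weight (k : nat) t : R := 2 ^+ k * t - (grid_index k t)%:~R.

Definition linear_interp (k : nat) (p : int -> 'rV[R]_n) t : 'rV[R]_n :=
  let j := grid_index k t in let om := grid_weight k t in
  (1 - om) *: p j + om *: p (j + 1).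

Definition geodesic_interp (k : nat) (v : int -> 'rV[R]_n) t : 'rV[R]_n :=
  let j := grid_index k t in
  geodesic_point (grid_weight k t) (v j) (v (j + 1)).

Definition points_converge (h : nat -> int -> 'rV[R]_n * 'rV[R]_n)
    (gamma : R -> 'rV[R]_n) : Prop :=
  forall e : R, 0 < e -> \forall k \near \oo, forall t,
    enorm (linear_interp k (fun j => (h k j).1) t - gamma t) < e.

Definition tangents_converge (h : nat -> int -> 'rV[R]_n * 'rV[R]_n)
    (nu : R -> 'rV[R]_n) : Prop :=
  (\forall k \near \oo, forall j : int, (h k (j + 1)).2 <> - (h k j).2) /\
  forall e : R, 0 < e -> \forall k \near \oo, forall t,
    angle (geodesic_interp k (fun j => (h k j).2) t) (nu t) < e.

Definition tangent_to (gamma nu : R -> 'rV[R]_n) : Prop := forall t,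
  (normalize (gamma s - gamma t) @[s --> t^'+] --> nu t) /\
  (normalize (gamma t - gamma s) @[s --> t^'-] --> nu t).

Definition G1_convergent (h : nat -> int -> 'rV[R]_n * 'rV[R]_n) : Prop :=
  exists gamma nu : R -> 'rV[R]_n,
    [/\ points_converge h gamma,
        (forall t, sphere (nu t)) /\ continuous nu,
        tangents_converge h nu &
        tangent_to gamma nu].

End HermiteBezier.

(* Main.v *)
Require Import Defs.
From Stdlib Require BinNums BinInt.
From mathcomp Require Import zify ssrZ ring lra.

(** Write u for the unit chord direction of two neighbouring data with unit
tangents a and b, and call 2 - <a,u> - <b,u> the defect of the pair: it bounds
|a - u|^2 / 2 and |b - u|^2 / 2, so it measures how far the pair is from lying
straight on its chord.  With s and d the half sum and half difference of the
two angles, c = cos s and g = cos d, the defect is 2 (1 - c g).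

The heart of the proof is that one averaging step contracts the defect.  The
two new chords have the directions of 2 (1 + c) u +- (a - b) and the new
tangent that of 3 (1 + c) u - (a + b), so the new cosines are explicit
functions of c, g, the skewness m = (<a,u> - <b,u>) / 2 and
z = (1 - <a,b>) / 2.  For nearly straight pairs a step multiplies the defect by
at most (7 + 3 sqrt 5) / 16 < 0.86 to leading order, which leaves enough room
to replace square roots by rational bounds ([cos_sum_ge]), to take the least z
(the planar configuration), and to replace m by an arithmetic-geometric mean
bound.  What remains are polynomial inequalities in c and g alone ([gap_near],
[gap_far]), which are checked by exact integer arithmetic, bisecting the unit
square.  The outcome is twofold:
- a pair of defect at most 9/5 is split into two pairs whose defects are at
  most 99/100 of it and whose chords are at most 21/22 of its chord
  ([average_near]);
- a pair with sigma <= 3 pi / 4 is split into two pairs of defect at most 9/5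
  ([average_initial]).
The first step is treated apart because the disc sigma <= 3 pi / 4 contains pairs
of defect larger than 2, whereas a pair of defect 2 may be degenerate: if one
tangent points along the chord and the other one opposite to it, a new chord
vanishes.

Hence from the first step on defects and chords decay geometrically.  An
interpolatory scheme with such a decay is G^1 convergent
([G1_of_geometric_decay]): points and tangents at dyadic parameters are Cauchy
with geometric rate, and near a parameter t all chords of a fine level point
almost along the limit tangent nu t.  So they lie in a narrow convex cone
around nu t; increments of the limit curve are limits of sums of such chords,
hence lie in the same cone, and they are nonzero since the curve interpolates
distinct points at arbitrarily fine levels. *)

Set Implicit Arguments.
Unset Strict Implicit.
Unset Printing Implicit Defensive.

Local Open Scope classical_set_scope.
Local Open Scope ring_scope.
Local Notation Z := BinNums.Z.

(** * Certified positivity of polynomials in two variables on the unit square *)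

(** Polynomials in one variable are coefficient lists, lowest degree first, and
polynomials in two variables are lists of such lists.  Both levels are
instances of one construction over an abstract coefficient type; [olow] is a
computable lower bound for the values of a coefficient. *)
Record coef_ops (T : Type) := CoefOps {
  ozero : T; oadd : T -> T -> T; omul : T -> T -> T; oscale : Z -> T -> T;
  olow : T -> Z }.

Definition Z_ops : coef_ops Z := CoefOps 0 +%R *%R *%R id.

Section PolynomialOps.
Context {T : Type} (o : coef_ops T).
Implicit Types (a : T) (p q : seq T) (k : nat).

Fixpoint padd p q :=
  match p, q with
  | [::], _ => q
  | _, [::] => p
  | a :: p', b :: q' => oadd o a b :: padd p' q'
  end.

Definition pmul p q :=
  foldr (fun a r => padd (map (omul o a) q) (ozero o :: r)) [::] p.

(** On [0, 1] one has a + x r >= a + min(0, r), so Horner's scheme can be run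
on lower bounds. *)
Definition plow p := foldr (fun a l => olow o a + Num.min 0 l) 0 p.

Definition poly_ops : coef_ops (seq T) :=
  CoefOps [::] padd pmul (fun z => map (oscale o z)) plow.

(** The substitution x := x / 2, multiplied by 2 ^ k to stay with integer
coefficients. *)
Fixpoint halve k p :=
  if p is a :: p' then oscale o (2 ^+ k) a :: halve k.-1 p' else [::].

Definition shift1 p :=
  foldr (fun a r => padd [:: a] (padd r (ozero o :: r))) [::] p.

End PolynomialOps.

Section Soundness.
Context {R : realFieldType}.

Definition ofZ (z : Z) : R := (int_of_Z z)%:~R.

Record sound (T : Type) (o : coef_ops T) (ev : T -> R) : Prop := Sound {
  ev0 : ev (ozero o) = 0;
  evD : forall a b, ev (oadd o a b) = ev a + ev b;
  evM : forall a b, ev (omul o a b) = ev a * ev b;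
  evZ : forall k a, ev (oscale o k a) = ofZ k * ev a;
  ev_low : forall a, ofZ (olow o a) <= ev a }.

Lemma ofZD a b : ofZ (a + b) = ofZ a + ofZ b.
Proof. by rewrite /ofZ raddfD rmorphD. Qed.

Lemma ofZM a b : ofZ (a * b) = ofZ a * ofZ b.
Proof. by rewrite /ofZ rmorphM rmorphM. Qed.

Lemma ofZ1 : ofZ 1 = 1.
Proof. by rewrite /ofZ rmorph1. Qed.

Lemma ofZX2 k : ofZ (2 ^+ k) = 2 ^+ k.
Proof. by rewrite /ofZ !rmorphXn. Qed.

Lemma ofZ_min0 a : ofZ (Num.min 0 a) = Num.min 0 (ofZ a).
Proof.
case: a => [|p|p] /=.
- by rewrite minxx minxx.
- by rewrite !min_l // /ofZ ler0z.
- by rewrite !min_r // /ofZ lerz0.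
Qed.

Lemma ofZ_gt0 a : 0 < a -> 0 < ofZ a.
Proof. by rewrite /ofZ ltr0z; case: a => //= p; lia. Qed.

Lemma Z_sound : sound Z_ops ofZ.
Proof. by split => //; [exact: ofZD | exact: ofZM | exact: ofZM]. Qed.

Definition peval (T : Type) (ev : T -> R) (x : R) (p : seq T) : R :=
  foldr (fun a r => ev a + x * r) 0 p.

Section Polynomials.
Context {T : Type} {o : coef_ops T} {ev : T -> R} (so : sound o ev).
Implicit Types (x : R) (p q : seq T).

Lemma peval_padd x p q :
  peval ev x (padd o p q) = peval ev x p + peval ev x q.
Proof.
elim: p q => [|a p IH] [|b q] /=; rewrite ?add0r ?addr0 //.
by rewrite IH (evD so); ring.
Qed.

Lemma peval_map x (k : R) (f : T -> T) p :
  (forall a, ev (f a) = k * ev a) -> peval ev x (map f p) = k * peval ev x p.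
Proof.
by move=> fE; elim: p => [|a p IH] /=; rewrite ?mulr0 // IH fE; ring.
Qed.

Lemma peval_low x p : 0 <= x <= 1 -> ofZ (plow o p) <= peval ev x p.
Proof.
move=> /andP[x0 x1]; elim: p => [|a p IH] /=; first by rewrite /ofZ.
rewrite ofZD ofZ_min0 lerD ?(ev_low so) //.
have [h|h] := lerP 0 (ofZ (plow o p)).
  by rewrite mulr_ge0 // (le_trans h).
by have := ler_wpM2l x0 IH; nra.
Qed.

Lemma poly_sound x : 0 <= x <= 1 -> sound (poly_ops o) (peval ev x).
Proof.
move=> x01; split => //=.
- exact: peval_padd.
- elim=> [|a p IH] q /=; first by rewrite mul0r.
  rewrite peval_padd (peval_map _ _ (evM so a)) /= (ev0 so) IH; ring.
- by move=> k p; rewrite (peval_map _ _ (evZ so k)).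
- by move=> p; exact: peval_low.
Qed.

Lemma peval_halve k x p : (size p <= k.+1)%N ->
  peval ev x (halve o k p) = 2 ^+ k * peval ev (x / 2) p.
Proof.
elim: p k => [|a p IH] k /=; first by rewrite mulr0.
rewrite (evZ so) ofZX2; case: k => [|k] sp.
  by case: p {IH} sp => [|b p] //= _; rewrite !mulr0 !addr0.
by rewrite IH //= exprS; field.
Qed.

Lemma peval_shift1 x p : peval ev x (shift1 o p) = peval ev (x + 1) p.
Proof.
elim: p => // a p IH.
rewrite -[shift1 o _]/(padd o [:: a] (padd o (shift1 o p) (ozero o :: shift1 o p))).
by rewrite !peval_padd /= (ev0 so) IH; ring.
Qed.

End Polynomials.
End Soundness.

(** The outer list is indexed by powers of x, the inner ones by powers of y. *)
Definition bipoly := seq (seq Z).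

Definition Zpoly_ops := poly_ops Z_ops.
Definition bipoly_ops := poly_ops Zpoly_ops.

Definition degx (P : bipoly) := (size P).-1.
Definition degy (P : bipoly) := (foldr (fun p => maxn (size p)) 0 P).-1.

Definition left_x P := halve Zpoly_ops (degx P) P.
Definition right_x P := shift1 Zpoly_ops (left_x P).
Definition left_y (P : bipoly) : bipoly := map (halve Z_ops (degy P)) P.
Definition right_y (P : bipoly) : bipoly := map (shift1 Z_ops) (left_y P).

(** Each polynomial is rescaled so that the current box is again the unit
square.  A box is accepted when one of the polynomials has a positive lower
bound on it; a region to be ignored is described by adding a polynomial that
is positive exactly there.  The conditional, unlike a boolean disjunction,
prevents an eager evaluator from descending into accepted boxes. *)
Fixpoint covered (fuel : nat) (Ps : seq bipoly) : bool :=
  if has (fun P => 0 < olow bipoly_ops P) Ps then true else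
  if fuel is f.+1 then
    let L := map left_x Ps in let H := map right_x Ps in
    [&& covered f (map left_y L), covered f (map right_y L),
        covered f (map left_y H) & covered f (map right_y H)]
  else false.

Section Bipolynomials.
Context {R : realFieldType}.
Implicit Types (x y : R) (P : bipoly).

Definition bieval x y P : R := peval (peval ofZ y) x P.

Lemma Zpoly_sound y : 0 <= y <= 1 -> sound Zpoly_ops (peval ofZ y).
Proof. exact: poly_sound Z_sound _. Qed.

Lemma bipoly_sound x y :
  0 <= x <= 1 -> 0 <= y <= 1 -> sound bipoly_ops (bieval x y).
Proof. by move=> x01 y01; exact: poly_sound (Zpoly_sound y01) _ x01. Qed.

Lemma bieval_left_x x y P : 0 <= y <= 1 ->
  bieval x y (left_x P) = 2 ^+ degx P * bieval (x / 2) y P.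
Proof.
by move=> /Zpoly_sound so; rewrite /bieval (peval_halve so) // /degx leqSpred.
Qed.

Lemma bieval_right_x x y P : 0 <= y <= 1 ->
  bieval x y (right_x P) = 2 ^+ degx P * bieval ((x + 1) / 2) y P.
Proof.
move=> y01; rewrite -bieval_left_x // /bieval.
by rewrite (peval_shift1 (Zpoly_sound y01)).
Qed.

Lemma bieval_left_y x y P :
  bieval x y (left_y P) = 2 ^+ degy P * bieval x (y / 2) P.
Proof.
rewrite /left_y; have: {in P, forall p, (size p <= (degy P).+1)%N}.
  move=> p pP; apply: leq_trans (leqSpred _); elim: P pP => //= q P IH.
  by rewrite inE leq_max => /predU1P[->|/IH ->]; rewrite ?leqnn ?orbT.
elim: P (degy P) => [|p P IH] k sP; rewrite /bieval /= ?mulr0 //.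
rewrite [peval _ _ (map _ _)]IH; last by move=> q qP; rewrite sP // inE qP orbT.
by rewrite (peval_halve Z_sound) ?sP ?mem_head // /bieval; ring.
Qed.

Lemma bieval_right_y x y P :
  bieval x y (right_y P) = 2 ^+ degy P * bieval x ((y + 1) / 2) P.
Proof.
rewrite -bieval_left_y /right_y /bieval; elim: (left_y P) => //= p Q ->.
by rewrite (peval_shift1 Z_sound).
Qed.

Lemma coveredP fuel Ps x y : 0 <= x <= 1 -> 0 <= y <= 1 ->
  covered fuel Ps -> has (fun P => 0 < bieval x y P) Ps.
Proof.
have low Qs (u v : R) : 0 <= u <= 1 -> 0 <= v <= 1 ->
    has (fun P => 0 < olow bipoly_ops P) Qs -> has (fun P => 0 < bieval u v P) Qs.
  move=> u01 v01; apply: sub_has => P /(@ofZ_gt0 R) P0.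
  exact: lt_le_trans P0 (ev_low (bipoly_sound u01 v01) P).
elim: fuel Ps x y => [|f IH] Ps x y x01 y01 /=.
  by case: ifP => // hP _; exact: low.
case: ifP => [hP _|_]; first exact: low.
have two k : 0 < 2 ^+ k :> R by rewrite exprn_gt0.
have splitP (u : R) : 0 <= u <= 1 ->
  {v : R | 0 <= v <= 1 & u = v / 2} + {v : R | 0 <= v <= 1 & u = (v + 1) / 2}.
  move=> u01; case: (lerP u (1 / 2)) => hu; [left; exists (2 * u) |
    right; exists (2 * u - 1)]; by [lra | field].
case: (splitP x x01) => [[x' x'01 ->]|[x' x'01 ->]];
case: (splitP y y01) => [[y' y'01 ->]|[y' y'01 ->]];
case/and4P => h1 h2 h3 h4;
[move: h1|move: h2|move: h3|move: h4] => /(IH _ _ _ x'01 y'01);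
by rewrite -map_comp has_map; apply: sub_has => P /=;
   rewrite ?bieval_left_y ?bieval_right_y ?pmulr_rgt0 //
     ?bieval_left_x ?bieval_right_x ?pmulr_rgt0 //; lra.
Qed.

End Bipolynomials.

(** Reified polynomials: [denote] unfolds to a readable formula over the field,
while [expand] is evaluated by the checker. *)
Inductive expr :=
  | Const of nat | VarX | VarY
  | Plus of expr & expr | Minus of expr & expr | Times of expr & expr.

Fixpoint expand (e : expr) : bipoly :=
  match e with
  | Const k => [:: [:: BinInt.Z.of_nat k]]
  | VarX => [:: [::]; [:: 1]]
  | VarY => [:: [:: 0; 1]]
  | Plus e f => oadd bipoly_ops (expand e) (expand f)
  | Minus e f => oadd bipoly_ops (expand e) (oscale bipoly_ops (- 1) (expand f))
  | Times e f => omul bipoly_ops (expand e) (expand f)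
  end.

Fixpoint denote (R : realFieldType) (x y : R) (e : expr) : R :=
  match e with
  | Const k => k%:R
  | VarX => x
  | VarY => y
  | Plus e f => denote x y e + denote x y f
  | Minus e f => denote x y e - denote x y f
  | Times e f => denote x y e * denote x y f
  end.

Lemma bieval_expand (R : realFieldType) (x y : R) e :
  0 <= x <= 1 -> 0 <= y <= 1 -> bieval x y (expand e) = denote x y e.
Proof.
move=> x01 y01; have so := bipoly_sound x01 y01.
elim: e => [k|||e IHe f IHf|e IHe f IHf|e IHe f IHf].
- rewrite /bieval /= !mulr0 !addr0 /ofZ.
  have -> : int_of_Z (BinInt.Z.of_nat k) = k by lia.
  by [].
- by rewrite /bieval /= [ofZ 1]ofZ1; ring.
- by rewrite /bieval /= [ofZ 1]ofZ1 [ofZ 0]/(0%:~R); ring.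
- by rewrite [LHS](evD so) IHe IHf.
- rewrite [LHS](evD so) [X in _ + X](evZ so) IHe IHf /=.
  have -> : ofZ (- 1) = - 1 :> R by [].
  by rewrite mulN1r.
- by rewrite [LHS](evM so) IHe IHf.
Qed.

(** * The two polynomial inequalities behind the contraction *)

Declare Scope expr_scope.
Delimit Scope expr_scope with expr.
Bind Scope expr_scope with expr.
Notation "a + b" := (Plus a b) : expr_scope.
Notation "a - b" := (Minus a b) : expr_scope.
Notation "a * b" := (Times a b) : expr_scope.
Notation "n %:P" := (Const n%N) : expr_scope.

(** [gap_expr] is [gap] below for l = i / j and T = tnum / tden, multiplied by
the positive constant 128 (2 i j)^2 tden that clears all denominators. *)
Section GapExpr.
Variables (i j tden : nat) (c g tnum : expr).

Definition gap_expr : expr :=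
  (let a := (2 * i * j)%N%:P in
   let m := (i ^ 2)%N%:P * (1%:P - c * c) + (j ^ 2)%N%:P * (1%:P - g * g) in
   let p := a * (1%:P + c) - m in
   let v := 9%:P * (1%:P + c) * (1%:P + c) + 4%:P * g * g
            - 12%:P * (1%:P + c) * c * g in
   let q := (1%:P + c) * (a * (3%:P + 3%:P * c - 2%:P * c * g) - 3%:P * m) in
   2%:P * tden%:P * p
     * (128%:P * ((1%:P + c) * (a * c * g - m) + a * (1%:P - g * g))
        + q * (48%:P - v))
   - 128%:P * tnum
     * (a * a * ((1%:P + c) * (1%:P + c) + (1%:P - g * g))
        - 2%:P * a * (1%:P + c) * m + p * p))%expr.

End GapExpr.

(** A pair that lies straight on its chord has c = g = 1, where the gap vanishes.
The chart c = 1 - x, g = 1 - x y of the triangle 0 <= c <= g <= 1 blows this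
corner up: the gap becomes x times a polynomial that is positive on the region
c g >= 1/10, and the factor x is removed by dropping a null coefficient. *)
Definition near_c : expr := (1%:P - VarX)%expr.
Definition near_g : expr := (1%:P - VarX * VarY)%expr.
Definition near_gap : expr :=
  gap_expr 4 5 50 near_c near_g (1%:P + 99%:P * (near_c * near_g))%expr.
Definition near_outside : expr := (1%:P - 10%:P * (near_c * near_g))%expr.

Lemma near_gap_head : expand near_gap = [:: 0] :: behead (expand near_gap).
Proof. by vm_compute. Qed.

Lemma near_covered : covered 7 [:: behead (expand near_gap); expand near_outside].
Proof. by vm_compute. Qed.

(** No corner has to be resolved here, and c may be slightly negative, whence
the affine chart c = 2 x - 1.  Two values of the weight l are offered, since
neither of them works on the whole region. *)
Definition far_c : expr := (2%:P * VarX - 1%:P)%expr.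
Definition far_gap (i j : nat) : expr := gap_expr i j 5 far_c VarY 1%:P.
Definition far_outside : seq expr :=
  [:: 10%:P * (far_c * VarY) - 1%:P; 41%:P - 50%:P * VarY - 70%:P * far_c;
      far_c - VarY]%expr.

Lemma far_covered :
  covered 8 (map expand [:: far_gap 2 3, far_gap 1 2 & far_outside]).
Proof. by vm_compute. Qed.

Section Gap.
Context {R : realFieldType}.
Implicit Types (c g l T x y : R).

(** An upper bound for sqrt ((1 - c^2) (1 - g^2)) by the inequality between
arithmetic and geometric mean with weight l > 0; it makes everything polynomial
in c and g, and is sharp where l^2 (1 - c^2) = 1 - g^2. *)
Definition skew_bound l c g := (l * (1 - c ^+ 2) + (1 - g ^+ 2) / l) / 2.

(** That the sum of the new cosines is at least T, multiplied by 2 p sqrt w with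
w a quarter of the squared length of the new chord vector, in the extremal
configuration m = - [skew_bound], z = 1 - g^2.  Here v is the squared length of
the new tangent vector, 1 / sqrt v is replaced by its tangent line (48 - v) / 128
at v = 16, and the last summand comes from sqrt w <= (w + p^2) / (2 p). *)
Definition gap l T c g :=
  let m := skew_bound l c g in let p := 1 + c - m in
  let v := 9 * (1 + c) ^+ 2 + 4 * g ^+ 2 - 12 * (1 + c) * (c * g) in
  ((1 + c) * (c * g - m) + (1 - g ^+ 2)
    + (1 + c) * (3 + 3 * c - 2 * (c * g) - 3 * m) * (48 - v) / 128) * (2 * p)
  - T * ((1 + c) ^+ 2 + (1 - g ^+ 2) - 2 * (1 + c) * m + p ^+ 2).

Lemma denote_gap (i j tden : nat) ec eg et x y :
  (0 < i)%N -> (0 < j)%N -> (0 < tden)%N ->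
  denote x y (gap_expr i j tden ec eg et) =
  128 * (2 * i%:R * j%:R) ^+ 2 * tden%:R
  * gap (i%:R / j%:R) (denote x y et / tden%:R) (denote x y ec) (denote x y eg).
Proof.
rewrite -!(ltr0n R) => i0 j0 t0.
rewrite /gap_expr /= /gap /skew_bound.
rewrite !natrM ?natrX; field.
by rewrite ?lt0r_neq0.
Qed.

Lemma bieval_cons0 x y (P : bipoly) : bieval x y ([:: 0] :: P) = x * bieval x y P.
Proof.
by rewrite /bieval /= mulr0 addr0 [ofZ 0]/(0%:~R) add0r.
Qed.

(** T = (1 + 99 c g) / 50 is 2 - 99/100 (2 - 2 c g): the new defect is to be at
most 99/100 of the old one. *)
Lemma gap_near c g : 0 <= c -> c <= g -> g <= 1 -> 1 / 10 <= c * g ->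
  0 <= gap (4 / 5) ((1 + 99 * (c * g)) / 50) c g.
Proof.
move=> c0 cg g1 cg_ge.
have [x [y [x01 y01 cE gE]]] :
    exists x y, [/\ 0 <= x <= 1, 0 <= y <= 1, c = 1 - x & g = 1 - x * y].
  have [c1|c1] := eqVneq c 1.
    by exists 0, 0; split; lra.
  have c1' : 0 < 1 - c by rewrite subr_gt0 lt_neqAle c1 (le_trans cg).
  exists (1 - c), ((1 - g) / (1 - c)); split.
  - lra.
  - by rewrite divr_ge0 ?ler_pdivrMr ?mul1r //; lra.
  - by ring.
  - by field; rewrite lt0r_neq0.
have dcE : denote x y near_c = c by rewrite cE.
have dgE : denote x y near_g = g by rewrite gE.
have := coveredP x01 y01 near_covered.
rewrite /has orbF bieval_expand //.
have -> : (0 < denote x y near_outside) = false.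
  have -> : denote x y near_outside = 1 - 10 * (c * g) by rewrite cE gE.
  by apply/negbTE; rewrite -leNgt; lra.
rewrite orbF => kpos.
have : 0 <= denote x y near_gap.
  rewrite -bieval_expand // near_gap_head.
  move: kpos; move: (behead _) => K kpos.
  by rewrite bieval_cons0 mulr_ge0 ?(ltW kpos) //; case/andP: x01.
rewrite denote_gap // pmulr_rge0 //.
have -> : denote x y (1%:P + 99%:P * (near_c * near_g))%expr = 1 + 99 * (c * g).
  by rewrite cE gE.
by rewrite dcE dgE.
Qed.

(** T = 1/5 asks for a new defect of at most 9/5.  The line g + 7/5 c = 41/50 is
close to a tangent of the image of the circle sigma = 3 pi / 4 in the
coordinates c and g. *)
Lemma gap_far c g : -1 <= c -> c <= g -> 0 <= g <= 1 -> c * g <= 1 / 10 ->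
  41 / 50 <= g + 7 / 5 * c ->
  0 < gap (2 / 3) (1 / 5) c g \/ 0 < gap (1 / 2) (1 / 5) c g.
Proof.
move=> c1 cg g01 cg_le cg_ge.
have x01 : 0 <= (1 + c) / 2 <= 1 by lra.
have := coveredP x01 g01 far_covered; set x := (1 + c) / 2.
have cE : c = 2 * x - 1 by rewrite /x; field.
have dcE : denote x g far_c = c by rewrite cE.
rewrite /map /far_outside /has orbF !bieval_expand //.
have -> : denote x g (10%:P * (far_c * VarY) - 1%:P)%expr = 10 * (c * g) - 1.
  by rewrite cE.
have -> : denote x g (41%:P - 50%:P * VarY - 70%:P * far_c)%expr =
  41 - 50 * g - 70 * c by rewrite cE.
have -> : denote x g (far_c - VarY)%expr = c - g by rewrite cE.
have -> : (0 < 10 * (c * g) - 1) = false by apply/negbTE; rewrite -leNgt; lra.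
have -> : (0 < 41 - 50 * g - 70 * c) = false by apply/negbTE; rewrite -leNgt; lra.
have -> : (0 < c - g) = false by apply/negbTE; rewrite -leNgt; lra.
rewrite !orbF => /orP.
by rewrite !denote_gap // dcE !pmulr_rgt0.
Qed.

End Gap.

(** * The sum of the two new cosines *)

Section Scalar.
Context {R : realType}.
Implicit Types (c g l m z T : R).

(** For unit vectors a, b, u described by c, g, m and z as in [coordinates]
below: a quarter of the squared length of w = 2 (1 + c) u + (a - b), the squared
length of y = 3 (1 + c) u - (a + b), half of the product <y, w>, and the sum of
the cosines of the angles of a and y with w. *)
Definition chord_sq c m z := (1 + c) ^+ 2 + z + 2 * (1 + c) * m.
Definition tangent_sq c g z := 9 * (1 + c) ^+ 2 + 4 - 4 * z - 12 * (1 + c) * (c * g).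
Definition tangent_chord c g m := (1 + c) * (3 + 3 * c - 2 * (c * g) + 3 * m).

Definition cos_sum c g m z :=
  ((1 + c) * (c * g + m) + z) / Num.sqrt (chord_sq c m z)
  + tangent_chord c g m
    / (Num.sqrt (chord_sq c m z) * Num.sqrt (tangent_sq c g z)).

Lemma ge_skew_bound l c g m : 0 < l -> -1 <= c <= 1 -> -1 <= g <= 1 ->
  m ^+ 2 = (1 - c ^+ 2) * (1 - g ^+ 2) -> - skew_bound l c g <= m.
Proof.
move=> l0 c1 g1 mE.
have c2 : 0 <= 1 - c ^+ 2 by nra.
have g2 : 0 <= 1 - g ^+ 2 by nra.
have mb0 : 0 <= skew_bound l c g.
  by have l0' := ltW l0; rewrite /skew_bound divr_ge0 // addr_ge0 ?mulr_ge0 ?invr_ge0.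
suff : m ^+ 2 <= skew_bound l c g ^+ 2.
  by move=> h; case: (lerP (- skew_bound l c g) m) => // mlt; nra.
rewrite mE -subr_ge0.
have -> : skew_bound l c g ^+ 2 - (1 - c ^+ 2) * (1 - g ^+ 2) =
  ((l * (1 - c ^+ 2) - (1 - g ^+ 2) / l) / 2) ^+ 2.
  by rewrite /skew_bound; field; rewrite lt0r_neq0.
exact: sqr_ge0.
Qed.

(** The value is (1 + c + m)^2 + (z - m^2), where z - m^2 >= c^2 (1 - g^2). *)
Lemma chord_sq_gt0 l c g m z : 0 < l -> - (1 / 3) < c <= 1 -> 0 <= g <= 1 ->
  m ^+ 2 = (1 - c ^+ 2) * (1 - g ^+ 2) -> 1 - g ^+ 2 <= z ->
  0 < 1 + c - skew_bound l c g -> 0 < chord_sq c m z.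
Proof.
move=> l0 c1 g1 mE z_ge p0.
have m_ge : - skew_bound l c g <= m by apply: ge_skew_bound mE => //; lra.
have g2 : 0 <= 1 - g ^+ 2 by nra.
have zm : 0 <= z - m ^+ 2.
  rewrite mE; have : 0 <= c ^+ 2 * (1 - g ^+ 2) by rewrite mulr_ge0 ?sqr_ge0.
  lra.
have pm : 0 < 1 + c + m by lra.
have -> : chord_sq c m z = (1 + c + m) ^+ 2 + (z - m ^+ 2).
  by rewrite /chord_sq; ring.
by rewrite ltr_wpDr // exprn_gt0.
Qed.

Lemma tangent_sq_gt0 c g z : - (1 / 3) < c <= 1 -> 0 <= g <= 1 -> z <= 1 ->
  0 < tangent_sq c g z.
Proof.
move=> c1 g1 z_le.
have h : 0 < 3 + 3 * c - 4 * (c * g) by case: (lerP 0 c) => hc; nra.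
have -> : tangent_sq c g z =
  4 * (1 - z) + 3 * (1 + c) * (3 + 3 * c - 4 * (c * g)).
  by rewrite /tangent_sq; ring.
by rewrite ltr_wpDl ?mulr_gt0 //; lra.
Qed.

(** With the rational bounds for the square roots the claim becomes affine in z
and in m, with nonnegative slopes because T <= p; so it is enough to have it at
the least values of z and m, which is the hypothesis on [gap]. *)
Lemma cos_sum_ge l c g m z T : 0 < l -> - (1 / 3) < c <= 1 -> 0 <= g <= 1 ->
  m ^+ 2 = (1 - c ^+ 2) * (1 - g ^+ 2) -> 1 - g ^+ 2 <= z -> z <= 1 ->
  0 < 1 + c - skew_bound l c g -> 0 <= T <= 1 + c - skew_bound l c g ->
  2 * (c * g) <= 3 * (1 + c - skew_bound l c g) -> 0 <= gap l T c g ->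
  T <= cos_sum c g m z.
Proof.
move=> l0 c1 g1 mE z_ge z_le p0 /andP[T0 Tp] cgp gap0.
have m_ge : - skew_bound l c g <= m by apply: ge_skew_bound mE => //; lra.
have n0 := chord_sq_gt0 l0 c1 g1 mE z_ge p0.
have v0 := tangent_sq_gt0 c1 g1 z_le.
set p := 1 + c - skew_bound l c g in p0 Tp cgp.
set n := chord_sq c m z in n0 *; set v := tangent_sq c g z in v0 *.
set q := tangent_chord c g m.
have q0 : 0 <= q.
  by rewrite mulr_ge0 //; move: m_ge cgp; rewrite /p; lra.
have sn : 0 < Num.sqrt n by rewrite sqrtr_gt0.
have sv : 0 < Num.sqrt v by rewrite sqrtr_gt0.
have sqrt_n_le : Num.sqrt n * (2 * p) <= n + p ^+ 2.
  rewrite -{2}(sqr_sqrtr (ltW n0)) -subr_ge0.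
  by have := sqr_ge0 (Num.sqrt n - p); lra.
have inv_sqrt_v_ge : (48 - v) / 128 <= (Num.sqrt v)^-1.
  rewrite ler_pdivrMr // mulrC ler_pdivlMr // -{1}(sqr_sqrtr (ltW v0)).
  (* with r = sqrt v the claim is r^3 - 48 r + 128 >= 0, a double root at 4 *)
  have : 0 <= (Num.sqrt v - 4) ^+ 2 * (Num.sqrt v + 8).
    by rewrite mulr_ge0 ?sqr_ge0 // addr_ge0 // ltW.
  lra.
have main : T * (n + p ^+ 2) <=
    ((1 + c) * (c * g + m) + z + q * ((48 - v) / 128)) * (2 * p).
  rewrite -subr_ge0.
  have -> : ((1 + c) * (c * g + m) + z + q * ((48 - v) / 128)) * (2 * p)
      - T * (n + p ^+ 2) =
    gap l T c g + (z - (1 - g ^+ 2)) * ((p - T) + p + q * p / 16)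
    + (m + skew_bound l c g) * (1 + c)
      * (2 * (p - T) + 3 * p * (48 - tangent_sq c g (1 - g ^+ 2)) / 64).
    by rewrite /gap /q /v /n /p /tangent_chord /tangent_sq /chord_sq; field.
  have v48 : 0 <= 48 - tangent_sq c g (1 - g ^+ 2).
    have cg_ge : 0 <= c * g + 1 / 3 by nra.
    have : 0 <= (1 + c) * (c * g + 1 / 3) by rewrite mulr_ge0 //; lra.
    have : (1 + c) ^+ 2 <= 4 by nra.
    have : g ^+ 2 <= 1 by nra.
    by rewrite /tangent_sq; lra.
  have qp : 0 <= q * p / 16 by rewrite divr_ge0 // mulr_ge0 // ltW.
  have vp : 0 <= 3 * p * (48 - tangent_sq c g (1 - g ^+ 2)) / 64.
    by rewrite divr_ge0 // !mulr_ge0 // ltW.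
  by apply: addr_ge0; [apply: addr_ge0 => //; apply: mulr_ge0 |
    apply: mulr_ge0; first apply: mulr_ge0]; lra.
have qv : q * ((48 - v) / 128) <= q / Num.sqrt v by rewrite ler_wpM2l.
rewrite /cos_sum -/n -/v -/q.
have -> : ((1 + c) * (c * g + m) + z) / Num.sqrt n
    + q / (Num.sqrt n * Num.sqrt v) =
  ((1 + c) * (c * g + m) + z + q / Num.sqrt v) / Num.sqrt n.
  by field; rewrite !lt0r_neq0.
rewrite ler_pdivlMr //.
have p2 : 0 < 2 * p by rewrite mulr_gt0.
rewrite -(ler_pM2r p2) -mulrA (le_trans (ler_wpM2l T0 sqrt_n_le)) //.
by rewrite (le_trans main) // ler_pM2r // lerD2l.
Qed.

Lemma cos_sum_near c g m z : 0 <= c -> c <= g -> g <= 1 -> 1 / 10 <= c * g ->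
  m ^+ 2 = (1 - c ^+ 2) * (1 - g ^+ 2) -> 1 - g ^+ 2 <= z -> z <= 1 ->
  [/\ 0 < chord_sq c m z, 0 < tangent_sq c g z &
      (1 + 99 * (c * g)) / 50 <= cos_sum c g m z].
Proof.
move=> c0 cg g1 cg_ge mE z_ge z_le.
have l0 : 0 < 4 / 5 :> R by lra.
have c1 : - (1 / 3) < c <= 1 by lra.
have g01 : 0 <= g <= 1 by lra.
have Tp : (1 + 99 * (c * g)) / 50 <= 1 + c - skew_bound (4 / 5) c g.
  have -> : 1 + c - skew_bound (4 / 5) c g =
    c - 1 / 40 + 2 / 5 * c ^+ 2 + 5 / 8 * g ^+ 2 by rewrite /skew_bound; field.
  have c_ge : 1 / 10 <= c by nra.
  case: (lerP c (4 / 5)) => hc.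
    (* for given c the difference is least at g = 1584/1000 c *)
    have := sqr_ge0 (g - 1584 / 1000 * c).
    have : 0 <= (c - 1 / 10) * (4 / 5 - c) by rewrite mulr_ge0 //; lra.
    lra.
  have : 0 <= (1 - g) * (198 / 100 * c - 5 / 8 * (1 + g)) by rewrite mulr_ge0 //; lra.
  have : 0 <= (1 - c) * (58 / 100 - 2 / 5 * c) by rewrite mulr_ge0 //; lra.
  lra.
have p0 : 0 < 1 + c - skew_bound (4 / 5) c g by apply: lt_le_trans Tp; lra.
split.
- exact: chord_sq_gt0 p0.
- exact: tangent_sq_gt0.
- by apply: (cos_sum_ge l0) => //; try lra; exact: gap_near.
Qed.

Lemma cos_sum_far c g m z : - (1 / 3) < c -> c <= g -> 0 <= g <= 1 ->
  c * g <= 1 / 10 -> 41 / 50 <= g + 7 / 5 * c ->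
  m ^+ 2 = (1 - c ^+ 2) * (1 - g ^+ 2) -> 1 - g ^+ 2 <= z -> z <= 1 ->
  [/\ 0 < chord_sq c m z, 0 < tangent_sq c g z &
      1 / 5 <= cos_sum c g m z].
Proof.
move=> c0 cg g01 cg_le far mE z_ge z_le.
have c1 : - (1 / 3) < c <= 1 by lra.
have by_gap l : 0 < l -> 1 / 5 <= 1 + c - skew_bound l c g -> 0 < gap l (1 / 5) c g ->
  [/\ 0 < chord_sq c m z, 0 < tangent_sq c g z &
      1 / 5 <= cos_sum c g m z].
  move=> l0 Tp gap0.
  have p0 : 0 < 1 + c - skew_bound l c g by apply: lt_le_trans Tp; lra.
  split.
  - exact: chord_sq_gt0 p0.
  - exact: tangent_sq_gt0.
  - by apply: (cos_sum_ge l0) => //; try lra.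
have [] := gap_far _ cg g01 cg_le far; first by lra.
- by apply: by_gap; [lra | rewrite /skew_bound; nra].
- by apply: by_gap; [lra | rewrite /skew_bound; nra].
Qed.

End Scalar.

(** * Numerical bounds for the cosine and pi *)

Section Taylor.
Context {R : realType}.
Implicit Types (x y : R).

Lemma ge0_of_derive (f f' : R -> R) : (forall x, is_derive x 1 f (f' x)) ->
  f 0 = 0 -> (forall x, 0 <= x -> 0 <= f' x) -> forall x, 0 <= x -> 0 <= f x.
Proof.
move=> fd f0 f'0 x x0.
have fc : {within `[0, x], continuous f}.
  apply: continuous_subspaceT => y.
  by apply/differentiable_continuous/derivable1_diffP; exact: ex_derive.
have [c c0x] := MVT_segment x0 (fun y _ => fd y) fc.
rewrite f0 !subr0 => ->; rewrite mulr_ge0 // f'0 //.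
by move: c0x; rewrite in_itv => /andP[].
Qed.

Lemma is_derive_monomial n (k x : R) :
  is_derive x 1 (fun y => y ^+ n / k) (n%:R * x ^+ n.-1 / k).
Proof.
have -> : (fun y : R => y ^+ n / k) = k^-1 \*: (id ^+ n).
  by apply/funext => y; rewrite /= exprfctE mulrC.
apply: (is_derive_eq (is_deriveZ k^-1 (is_deriveX n (is_derive_id x 1)))).
by rewrite /GRing.scale /= mulr1 mulrC.
Qed.

Lemma taylor_sin1_le x : 0 <= x -> sin x <= x.
Proof.
rewrite -[sin x <= x]subr_ge0.
apply: (ge0_of_derive (f := fun y => y - sin y) (f' := fun y => 1 - cos y)) x.
- by rewrite /= sin0 subrr.
- by move=> x _; rewrite subr_ge0 cos_le1.
Qed.

Lemma taylor_cos2_ge x : 0 <= x -> 1 - x ^+ 2 / 2 <= cos x.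
Proof.
rewrite -[_ <= cos x]subr_ge0.
apply: (ge0_of_derive (f := fun y => cos y - (1 - y ^+ 2 / 2))
  (f' := fun y => y - sin y)) x.
- by move=> x; apply: is_derive_eq; rewrite /GRing.scale /=; field.
- by rewrite /= cos0; field.
- by move=> x x0; rewrite subr_ge0 taylor_sin1_le.
Qed.

Lemma taylor_sin3_ge x : 0 <= x -> x - x ^+ 3 / 6 <= sin x.
Proof.
rewrite -[_ <= sin x]subr_ge0.
apply: (ge0_of_derive (f := fun y => sin y - (y - y ^+ 3 / 6))
  (f' := fun y => cos y - (1 - y ^+ 2 / 2))) x.
- by move=> x; apply: is_derive_eq; rewrite /GRing.scale /=; field.
- by rewrite /= sin0; field.
- by move=> x x0; rewrite subr_ge0 taylor_cos2_ge.
Qed.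

Lemma taylor_cos4_le x : 0 <= x -> cos x <= 1 - x ^+ 2 / 2 + x ^+ 4 / 24.
Proof.
rewrite -[cos x <= _]subr_ge0.
apply: (ge0_of_derive (f := fun y => 1 - y ^+ 2 / 2 + y ^+ 4 / 24 - cos y)
  (f' := fun y => sin y - (y - y ^+ 3 / 6))) x.
- by move=> x; apply: is_derive_eq; rewrite /GRing.scale /=; field.
- by rewrite /= cos0; field.
- by move=> x x0; rewrite subr_ge0 taylor_sin3_ge.
Qed.

Lemma taylor_sin5_le x : 0 <= x -> sin x <= x - x ^+ 3 / 6 + x ^+ 5 / 120.
Proof.
rewrite -[sin x <= _]subr_ge0.
apply: (ge0_of_derive (f := fun y => y - y ^+ 3 / 6 + y ^+ 5 / 120 - sin y)
  (f' := fun y => 1 - y ^+ 2 / 2 + y ^+ 4 / 24 - cos y)) x.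
- by move=> x; apply: is_derive_eq; rewrite /GRing.scale /=; field.
- by rewrite /= sin0; field.
- by move=> x x0; rewrite subr_ge0 taylor_cos4_le.
Qed.

Lemma taylor_cos6_ge x : 1 - x ^+ 2 / 2 + x ^+ 4 / 24 - x ^+ 6 / 720 <= cos x.
Proof.
wlog x0 : x / 0 <= x.
  move=> h; have [/h//|/ltW x0] := lerP 0 x.
  have := h (- x); rewrite oppr_ge0 cosN => /(_ x0).
  by rewrite ![(- x) ^+ _]exprNn /= -signr_odd /= ; lra.
move: x0; rewrite -[_ <= cos x]subr_ge0.
apply: (ge0_of_derive
  (f := fun y => cos y - (1 - y ^+ 2 / 2 + y ^+ 4 / 24 - y ^+ 6 / 720))
  (f' := fun y => y - y ^+ 3 / 6 + y ^+ 5 / 120 - sin y)) x.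
- move=> {}x; have m n k := is_derive_monomial n k x.
  have d := is_deriveB (is_deriveD (is_deriveB (is_derive_cst (1 : R) x 1)
    (m 2%N 2)) (m 4%N 24)) (m 6%N 720).
  by apply: (is_derive_eq (is_deriveB (is_derive_cos x) d)); rewrite /=; field.
- by rewrite /= cos0; field.
- by move=> x x0; rewrite subr_ge0 taylor_sin5_le.
Qed.

(** If pi / 4 exceeded 63/80, its cosine 1 / sqrt 2 would be below the value of
the Taylor polynomial at 63/80, which is smaller than 1 / sqrt 2. *)
Lemma pi_le : pi <= 63 / 20 :> R.
Proof.
rewrite leNgt; apply/negP => pi_gt.
have y0 : 0 <= 63 / 80 :> R by lra.
have := taylor_cos4_le y0.
have yp : 63 / 80 < pi / 4 :> R by lra.
have c1 : cos (pi / 4 : R) < cos (63 / 80).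
  by rewrite ltr_cos // in_itv /=; have := pi_ge2 R; lra.
have c2 : 2 * cos (pi / 4 : R) ^+ 2 = 1.
  have := cos_pihalf R; rewrite (_ : pi / 2 = pi / 4 + pi / 4); last by field.
  by rewrite cosD -!expr2 sin2cos2; lra.
have c0 : 0 <= cos (pi / 4 : R).
  by rewrite cos_ge0_pihalf //; have := pi_ge2 R; lra.
by nra.
Qed.

(** In terms of s^2 and d^2 the Taylor polynomials are decreasing and convex, so
the worst case lies on the circle s^2 + d^2 = const, where a convex cubic in
s^2 with minimum near 23/10 has to be bounded. *)
Lemma cos_pair_ge s d : s ^+ 2 + d ^+ 2 <= (3 * pi / 4) ^+ 2 / 2 :> R ->
  41 / 50 <= cos d + 7 / 5 * cos s.
Proof.
move=> sd.
have sd' : s ^+ 2 + d ^+ 2 <= 28 / 10.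
  apply: le_trans sd _; have := @pi_le; have := pi_ge2 R; nra.
have := taylor_cos6_ge s; have := taylor_cos6_ge d.
rewrite !(exprM _ 2 2) !(exprM _ 2 3).
have := sqr_ge0 s; have := sqr_ge0 d.
move: (s ^+ 2) (d ^+ 2) sd' => X Y XY Y0 X0 hY hX.
pose Z := 28 / 10 - X.
have YZ : 0 <= (Z - Y) * (1 / 2 - (Z + Y) / 24 + (Z ^+ 2 + Z * Y + Y ^+ 2) / 720).
  have Z0 : 0 <= Z by rewrite /Z; lra.
  have ZY0 := mulr_ge0 Z0 Y0; have := sqr_ge0 Z; have := sqr_ge0 Y.
  by move=> Y20 Z20; apply: mulr_ge0; move: ZY0 Y20 Z20; rewrite /Z; lra.
have : 0 <= 7 / 5 * (1 - X / 2 + X ^+ 2 / 24 - X ^+ 3 / 720)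
   + (1 - Z / 2 + Z ^+ 2 / 24 - Z ^+ 3 / 720) - 41 / 50.
  rewrite /Z; have := sqr_ge0 (X - 23 / 10); have : X <= 28 / 10 by lra.
  move=> h1 h2; nra.
by move: YZ; rewrite /Z; lra.
Qed.

End Taylor.

(** * Euclidean geometry of row vectors *)

Section Euclid.
Context {R : realType} {n : nat}.
Implicit Types (u v w x : 'rV[R]_n) (k : R).

Lemma dotC v w : dot v w = dot w v.
Proof. by apply: eq_bigr => i _; rewrite mulrC. Qed.

Lemma dotDl u v w : dot (u + v) w = dot u w + dot v w.
Proof. by rewrite /dot -big_split; apply: eq_bigr => i _; rewrite mxE mulrDl. Qed.

Lemma dotZl k v w : dot (k *: v) w = k * dot v w.
Proof. by rewrite /dot mulr_sumr; apply: eq_bigr => i _; rewrite mxE mulrA. Qed.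

Lemma dotNl v w : dot (- v) w = - dot v w.
Proof. by rewrite -scaleN1r dotZl mulN1r. Qed.

Lemma dotDr u v w : dot u (v + w) = dot u v + dot u w.
Proof. by rewrite dotC dotDl !(dotC _ u). Qed.

Lemma dotZr k v w : dot v (k *: w) = k * dot v w.
Proof. by rewrite dotC dotZl dotC. Qed.

Lemma dotNr v w : dot v (- w) = - dot v w.
Proof. by rewrite dotC dotNl dotC. Qed.

Lemma dot0l w : dot 0 w = 0.
Proof. by rewrite -(scale0r 0) dotZl mul0r. Qed.

Definition dotE := (dotDl, dotDr, dotNl, dotNr, dotZl, dotZr).

Lemma dot_ge0 v : 0 <= dot v v.
Proof. by apply: sumr_ge0 => i _; rewrite -expr2 sqr_ge0. Qed.

Lemma dot_eq0 v : dot v v = 0 -> v = 0.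
Proof.
move=> /eqP; rewrite psumr_eq0 => [/allP v0|i _]; last by rewrite -expr2 sqr_ge0.
apply/rowP => i; rewrite mxE; apply/eqP.
by have := v0 i (mem_index_enum i); rewrite mulf_eq0 orbb.
Qed.

Lemma enorm_ge0 v : 0 <= enorm v.
Proof. exact: sqrtr_ge0. Qed.

Lemma sqr_enorm v : enorm v ^+ 2 = dot v v.
Proof. by rewrite sqr_sqrtr // dot_ge0. Qed.

Lemma enorm_eq0 v : enorm v = 0 -> v = 0.
Proof. by move=> v0; apply: dot_eq0; rewrite -sqr_enorm v0 expr0n. Qed.

Lemma enorm_gt0 v : v <> 0 -> 0 < enorm v.
Proof.
by move=> v0; rewrite lt_neqAle enorm_ge0 andbT eq_sym; apply/eqP => /enorm_eq0.
Qed.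

Lemma enorm0 : enorm (0 : 'rV[R]_n) = 0.
Proof. by rewrite /enorm dot0l sqrtr0. Qed.

Lemma enormZ k v : 0 <= k -> enorm (k *: v) = k * enorm v.
Proof.
move=> k0; rewrite /enorm dotZl dotZr mulrA -expr2 sqrtrM ?sqr_ge0 //.
by rewrite sqrtr_sqr ger0_norm.
Qed.

Lemma enormN v : enorm (- v) = enorm v.
Proof. by rewrite /enorm dotNl dotNr opprK. Qed.

Lemma enormBC v w : enorm (v - w) = enorm (w - v).
Proof. by rewrite -enormN opprB. Qed.

Lemma dot_le v w : dot v w <= enorm v * enorm w.
Proof.
have [->|/eqP v0] := eqVneq v 0.
  by rewrite enorm0 mul0r dot0l.
have [->|/eqP w0] := eqVneq w 0.
  by rewrite enorm0 mulr0 dotC dot0l.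
have a0 := enorm_gt0 v0; have b0 := enorm_gt0 w0.
have := dot_ge0 (enorm w *: v - enorm v *: w).
rewrite !dotE (dotC w v) -!sqr_enorm; set a := enorm v in a0 *; set b := enorm w in b0 *.
move=> h; have : 0 <= (2 * a * b) * (a * b - dot v w) by lra.
by rewrite pmulr_rge0 ?subr_ge0 // !mulr_gt0.
Qed.

Lemma ler_enormD v w : enorm (v + w) <= enorm v + enorm w.
Proof.
rewrite -(@ler_pXn2r _ 2) // ?nnegrE ?addr_ge0 ?enorm_ge0 // sqr_enorm !dotE.
by rewrite sqrrD !sqr_enorm (dotC w v); have := dot_le v w; lra.
Qed.

Lemma ler_enormB_trans v u w : enorm (u - w) <= enorm (u - v) + enorm (v - w).
Proof. by rewrite (le_trans _ (ler_enormD _ _)) // addrA subrK. Qed.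

Lemma sqr_enormB v w :
  enorm (v - w) ^+ 2 = enorm v ^+ 2 + enorm w ^+ 2 - 2 * dot v w.
Proof. by rewrite !sqr_enorm !dotE (dotC w v); ring. Qed.

Lemma dot_unit v w : enorm v = 1 -> enorm w = 1 -> -1 <= dot v w <= 1.
Proof.
move=> v1 w1; have := dot_le v w; have := dot_le (- v) w.
by rewrite dotNl enormN v1 w1; lra.
Qed.

Lemma enorm_normalize v : v <> 0 -> enorm (normalize v) = 1.
Proof.
move=> /enorm_gt0 v0; rewrite /normalize enormZ ?invr_ge0 ?ltW //.
by rewrite mulVf // lt0r_neq0.
Qed.

Lemma normalizeK v : v <> 0 -> enorm v *: normalize v = v.
Proof.
move=> /enorm_gt0 v0; rewrite /normalize scalerA mulfV ?scale1r //.
by rewrite lt0r_neq0.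
Qed.

Lemma normalizeZ k v : 0 < k -> normalize (k *: v) = normalize v.
Proof.
move=> k0; rewrite /normalize enormZ ?ltW // scalerA invfM.
by rewrite mulrAC mulVf ?mul1r // lt0r_neq0.
Qed.

Lemma ler_coord_enorm v i : `|v 0 i| <= enorm v.
Proof.
rewrite -sqrtr_sqr ler_sqrt ?dot_ge0 // /dot (bigD1 i) //= -expr2.
by rewrite lerDl sumr_ge0 // => j _; rewrite -expr2 sqr_ge0.
Qed.

Lemma enorm_le_coord v k : (forall i, `|v 0 i| <= k) -> enorm v <= n%:R * k.
Proof.
move=> vk; apply: (@le_trans _ _ (\sum_i `|v 0 i|)).
  have s0 : 0 <= \sum_i `|v 0 i| by exact: sumr_ge0.
  rewrite -(@ler_pXn2r _ 2) // ?nnegrE ?enorm_ge0 // sqr_enorm.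
  rewrite [leRHS]expr2 mulr_suml ler_sum // => i _.
  rewrite -expr2 -real_normK ?num_real // expr2 ler_wpM2l //.
  by rewrite (bigD1 i) //= lerDl sumr_ge0.
rewrite (le_trans (ler_sum _ (fun i _ => vk i))) // sumr_const card_ord.
by rewrite mulr_natl.
Qed.

(** The topology of row vectors comes from the sup norm, so Euclidean estimates
give convergence through this comparison. *)
Lemma norm_le_enorm v : `|v| <= enorm v.
Proof.
rewrite /Num.norm /=; have [->|] := eqVneq (mx_norm v) 0; first exact: enorm_ge0.
by case/mx_norm_neq0 => -[i j] ->; rewrite ord1 ler_coord_enorm.
Qed.

(** The difference quotient is the polynomial b + h A + h^2 B in the increment. *)
Lemma derive1_bezier3_half (p0 p1 p2 p3 : 'rV[R]_n) :
  derive1 (bezier3 p0 p1 p2 p3) (1 / 2) = (3 / 4) *: (p3 - p0 + (p2 - p1)).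
Proof.
set b := RHS.
pose A := (3 / 2) *: (p3 - p2 - p1 + p0).
pose B := p3 - p0 + 3 *: (p1 - p2).
apply/cvg_lim; first exact: norm_hausdorff.
suff : (fun h : R => b + (h *: A + h ^+ 2 *: B)) @ 0^' --> b.
  apply: cvg_trans; apply: near_eq_cvg; near=> h.
  have h0 : h != 0 by near: h; exact: nbhs_dnbhs_neq.
  apply: (scalerI h0); rewrite [RHS]scalerA mulfV // scale1r.
  by apply/rowP => i; rewrite !mxE /=; field.
have cid : (fun h : R => h) @ 0^' --> (0 : R) by apply: cvg_within_filter; exact: cvg_id.
have -> : nbhs b = nbhs (b + (0 *: A + 0 *: B)) by rewrite !scale0r !addr0.
apply: cvgD; first exact: cvg_cst.
apply: cvgD; apply: cvgZr_tmp => //.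
have c2 : (fun h : R => h ^+ 2) @ 0^' --> (0 * 0 : R) by apply: (cvgM cid cid).
by rewrite mulr0 in c2.
Unshelve. all: by end_near.
Qed.

End Euclid.

(** * One averaging step *)

Section Step.
Context {R : realType} {n : nat}.
Implicit Types (u v w x a b : 'rV[R]_n) (c g m z T : R) (h k : 'rV[R]_n * 'rV[R]_n).

(** The shape of a Hermite pair with tangents a, b and chord direction u: for
half sum s and half difference d of the angles of a and b with u, one has
c = cos s, g = cos d, m = - sin s sin d and z = (1 - <a,b>) / 2. *)
Record coordinates a b u c g m z : Prop := Coordinates {
  dot_au : dot a u = c * g + m;
  dot_bu : dot b u = c * g - m;
  dot_ab : dot a b = 1 - 2 * z;
  skew_sqr : m ^+ 2 = (1 - c ^+ 2) * (1 - g ^+ 2);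
  c_le_g : c <= g; g_ge0 : 0 <= g; g_le1 : g <= 1;
  z_ge : 1 - g ^+ 2 <= z; z_le : z <= 1 }.

(** Exchanging the tangents, which reduces the second of the two new pairs to the
first. *)
Lemma coordinatesC a b u c g m z :
  coordinates a b u c g m z -> coordinates b a u c g (- m) z.
Proof. by case=> *; split=> //; rewrite ?opprK ?sqrrN // dotC. Qed.

Lemma acos_bounds (y : R) : -1 <= y <= 1 -> 0 <= acos y <= pi.
Proof. by move=> y1; rewrite acos_ge0 ?acos_lepi. Qed.

Lemma angle_coordinates a b u :
  enorm a = 1 -> enorm b = 1 -> enorm u = 1 ->
  let s := (angle a u + angle b u) / 2 in
  let d := (angle a u - angle b u) / 2 in
  coordinates a b u (cos s) (cos d) (- (sin s * sin d)) ((1 - dot a b) / 2).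
Proof.
move=> a1 b1 u1 s d.
have au := dot_unit a1 u1; have bu := dot_unit b1 u1.
have /andP[t0_ge t0_le] := acos_bounds au; have /andP[t1_ge t1_le] := acos_bounds bu.
have ca : cos (angle a u) = dot a u by rewrite /angle acosK.
have cb : cos (angle b u) = dot b u by rewrite /angle acosK.
have saE : angle a u = s + d by rewrite /s /d; field.
have sbE : angle b u = s - d by rewrite /s /d; field.
have half_ge0 (t : R) : 0 <= t -> t <= pi -> 0 <= sin (t / 2).
  by move=> *; rewrite sin_ge0_pi //; lra.
split.
- by rewrite -ca saE cosD.
- by rewrite -cb sbE cosB; ring.
- by field.
- by rewrite sqrrN exprMn !sin2cos2.
- have -> : s = angle a u / 2 + angle b u / 2 by rewrite /s; field.
  have -> : d = angle a u / 2 - angle b u / 2 by rewrite /d; field.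
  rewrite cosD cosB -subr_ge0.
  have := mulr_ge0 (half_ge0 _ t0_ge t0_le) (half_ge0 _ t1_ge t1_le).
  by rewrite /angle; lra.
- by rewrite cos_ge0_pihalf // /d /angle; lra.
- exact: cos_le1.
(* Cauchy-Schwarz for the components of a and b orthogonal to u gives
   <a,b> <= cos (2 d), that is, z is least in the planar case *)
- have sin_proj (v : 'rV[R]_n) :
      enorm v = 1 -> enorm (v - dot v u *: u) = sin (angle v u).
    move=> v1; have vu := dot_unit v1 u1.
    rewrite /angle sin_acos // /enorm; congr Num.sqrt.
    by rewrite !dotE -!sqr_enorm v1 u1 (dotC u v); ring.
  have := dot_le (a - dot a u *: u) (b - dot b u *: u).
  rewrite !sin_proj // !dotE -(sqr_enorm u) u1 (dotC u b).
  have : cos (angle a u - angle b u) = 2 * cos d ^+ 2 - 1.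
    have -> : angle a u - angle b u = d + d by rewrite /d; field.
    by rewrite cosD -!expr2 sin2cos2; ring.
  by rewrite cosB ca cb; lra.
- by have := dot_unit a1 b1; lra.
Qed.

Definition chord_dir c u a b := (2 * (1 + c)) *: u + (a - b).
Definition tangent_dir c u a b := (3 * (1 + c)) *: u - (a + b).

Lemma cos_sum_half a b u c g m z :
  enorm a = 1 -> enorm b = 1 -> enorm u = 1 ->
  coordinates a b u c g m z -> 0 < chord_sq c m z -> 0 < tangent_sq c g z ->
  let w := chord_dir c u a b in let y := tangent_dir c u a b in
  [/\ w <> 0, y <> 0 &
    dot a (normalize w) + dot (normalize y) (normalize w) = cos_sum c g m z].
Proof.
move=> a1 b1 u1 co n0 v0 w y.
have wE : dot w w = 4 * chord_sq c m z.
  rewrite /w /chord_dir /chord_sq !dotE -!sqr_enorm a1 b1 u1.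
  rewrite (dotC u a) (dotC u b) (dotC b a) (dot_au co) (dot_bu co) (dot_ab co); ring.
have yE : dot y y = tangent_sq c g z.
  rewrite /y /tangent_dir /tangent_sq !dotE -!sqr_enorm a1 b1 u1.
  rewrite (dotC u a) (dotC u b) (dotC b a) (dot_au co) (dot_bu co) (dot_ab co); ring.
have sn : 0 < Num.sqrt (chord_sq c m z) by rewrite sqrtr_gt0.
have sv : 0 < Num.sqrt (tangent_sq c g z) by rewrite sqrtr_gt0.
have w_norm : enorm w = 2 * Num.sqrt (chord_sq c m z).
  rewrite /enorm wE sqrtrM // (_ : 4 = 2 ^+ 2) ?sqrtr_sqr ?ger0_norm //; ring.
have y_norm : enorm y = Num.sqrt (tangent_sq c g z) by rewrite /enorm yE.
split.
- by move=> w0; move: w_norm; rewrite w0 enorm0; lra.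
- by move=> y0; move: y_norm; rewrite y0 enorm0; lra.
have awE : dot a w = 2 * ((1 + c) * (c * g + m) + z).
  rewrite /w /chord_dir !dotE -!sqr_enorm a1 (dot_au co) (dot_ab co); ring.
have ywE : dot y w = 2 * tangent_chord c g m.
  rewrite /w /y /chord_dir /tangent_dir /tangent_chord !dotE -!sqr_enorm a1 b1 u1.
  rewrite (dotC u a) (dotC u b) (dotC b a) (dot_au co) (dot_bu co) (dot_ab co); ring.
rewrite /cos_sum /normalize !dotZr !dotZl awE ywE w_norm y_norm; field.
by rewrite !lt0r_neq0.
Qed.

Definition direction h k := normalize (k.1 - h.1).

(** As 2 cos^2 (s / 2) = 1 + c, the length alpha in the Bezier average is
2 L / (3 (1 + c)), where L is the length of the chord. *)
Lemma average_half h k c : enorm h.2 = 1 -> enorm k.2 = 1 -> h.1 <> k.1 ->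
  c = cos ((theta0 h k + theta1 h k) / 2) -> 0 < 1 + c ->
  let u := direction h k in
  let r := enorm (k.1 - h.1) / (4 * (1 + c)) in
  [/\ (average h k).1 - h.1 = r *: chord_dir c u h.2 k.2,
      k.1 - (average h k).1 = r *: chord_dir c u k.2 h.2 &
      (average h k).2 = normalize (tangent_dir c u h.2 k.2)].
Proof.
move=> h1 k1 hk cs c0 u r.
have kh : k.1 - h.1 <> 0 by move/eqP; rewrite subr_eq0 => /eqP/esym.
rewrite {}/r; set L := enorm (k.1 - h.1).
have L0 : 0 < L := enorm_gt0 kh.
have kE : k.1 = h.1 + L *: u by rewrite normalizeK // addrC subrK.
have cE : cos ((theta0 h k + theta1 h k) / 4) ^+ 2 = (1 + c) / 2.
  rewrite cs; set th := theta0 h k + theta1 h k.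
  rewrite (_ : th / 2 = th / 4 + th / 4); last by field.
  by rewrite cosD -!expr2 sin2cos2; field.
have aE : average_alpha h k = 2 * L / (3 * (1 + c)).
  by rewrite /average_alpha cE -/L; field; rewrite lt0r_neq0.
rewrite /average /average_curve /= aE derive1_bezier3_half; split.
- apply/rowP => i; rewrite /bezier3 /chord_dir kE !mxE.
  by field; rewrite !lt0r_neq0.
- apply/rowP => i; rewrite /bezier3 /chord_dir kE !mxE.
  by field; rewrite !lt0r_neq0.
rewrite -(normalizeZ (tangent_dir c u h.2 k.2) (_ : 0 < L / (2 * (1 + c)))); last first.
  by rewrite divr_gt0 // mulr_gt0.
congr normalize; apply/rowP => i; rewrite /tangent_dir kE !mxE.
by field; rewrite !lt0r_neq0.
Qed.

Definition defect h k := 2 - dot h.2 (direction h k) - dot k.2 (direction h k).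

(** The chord estimate is the triangle inequality: the new chord has length
L / (4 (1 + c)) times |2 (1 + c) u +- (a - b)| <= 2 (1 + c) + 2. *)
Lemma average_spec h k T : enorm h.2 = 1 -> enorm k.2 = 1 -> h.1 <> k.1 ->
  let s := (theta0 h k + theta1 h k) / 2 in
  let d := (theta0 h k - theta1 h k) / 2 in
  let c := cos s in let g := cos d in
  - 1 < c ->
  (forall m z, m ^+ 2 = (1 - c ^+ 2) * (1 - g ^+ 2) -> 1 - g ^+ 2 <= z -> z <= 1 ->
    [/\ 0 < chord_sq c m z, 0 < tangent_sq c g z &
     T <= cos_sum c g m z]) ->
  let l := 1 / 2 + 1 / (2 * (1 + c)) in
  let e := average h k in
  [/\ average_dom h k, enorm e.2 = 1,
    [/\ h.1 <> e.1, defect h e <= 2 - T &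
        enorm (e.1 - h.1) <= l * enorm (k.1 - h.1)] &
    [/\ e.1 <> k.1, defect e k <= 2 - T &
        enorm (k.1 - e.1) <= l * enorm (k.1 - h.1)]].
Proof.
move=> h1 k1 hk s d c g c_gt bound l e.
have c0 : 0 < 1 + c by lra.
have kh : k.1 - h.1 <> 0 by move/eqP; rewrite subr_eq0 => /eqP/esym.
have u1 : enorm (direction h k) = 1 := enorm_normalize kh.
pose m := - (sin s * sin d); pose z := (1 - dot h.2 k.2) / 2.
have co : coordinates h.2 k.2 (direction h k) c g m z := angle_coordinates h1 k1 u1.
have co' := coordinatesC co.
have [n0 v0 Tl] := bound _ _ (skew_sqr co) (z_ge co) (z_le co).
have [n0' _ Tr] := bound _ _ (skew_sqr co') (z_ge co') (z_le co').
have [w0 y0 wE] := cos_sum_half h1 k1 u1 co n0 v0.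
have [w0' y0' wE'] := cos_sum_half k1 h1 u1 co' n0' v0.
have [hE kE eE] := average_half h1 k1 hk (erefl c) c0.
rewrite -/e in hE kE eE.
set r := _ / (4 * _) in hE kE.
have r0 : 0 < r by rewrite divr_gt0 ?enorm_gt0 // mulr_gt0.
have dir_le a b : enorm a = 1 -> enorm b = 1 ->
    r * enorm (chord_dir c (direction h k) a b) <= l * enorm (k.1 - h.1).
  move=> a1 b1; apply: (@le_trans _ _ (r * (2 * (1 + c) + 2))).
    rewrite ler_pM2l // /chord_dir (le_trans (ler_enormD _ _)) //.
    rewrite enormZ ?u1; last by lra.
    rewrite mulr1 lerD2l (le_trans (ler_enormD _ _)) // enormN a1 b1; lra.
  rewrite le_eqVlt; apply/orP; left; apply/eqP.
  by rewrite /r /l; field; rewrite lt0r_neq0.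
split.
- split=> //; rewrite ltNge; apply/negP => hs.
  have co1 := acos_bounds (dot_unit h1 u1); have co2 := acos_bounds (dot_unit k1 u1).
  suff : c = -1 by lra.
  rewrite /c (_ : s = pi) ?cospi // /s /theta0 /theta1 /angle.
  by move: hs co1 co2; rewrite /theta0 /theta1 /angle /direction; lra.
- by rewrite eE enorm_normalize.
- split.
  + move=> he; case: w0; move: hE; rewrite he subrr => /esym/eqP.
    by rewrite scaler_eq0 gt_eqF //= => /eqP.
  + by rewrite /defect /direction hE normalizeZ // eE; move: wE Tl; lra.
  + by rewrite hE enormZ ?(ltW r0) //; exact: dir_le.
- split.
  + move=> he; case: w0'; move: kE; rewrite he subrr => /esym/eqP.
    by rewrite scaler_eq0 gt_eqF //= => /eqP.
  + rewrite /defect /direction kE normalizeZ // eE; move: wE' Tr.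
    by rewrite /tangent_dir (addrC k.2); lra.
  + by rewrite kE enormZ ?(ltW r0) //; exact: dir_le.
Qed.

Lemma defectE h k : enorm h.2 = 1 -> enorm k.2 = 1 -> h.1 <> k.1 ->
  let c := cos ((theta0 h k + theta1 h k) / 2) in
  let g := cos ((theta0 h k - theta1 h k) / 2) in
  [/\ defect h k = 2 - 2 * (c * g), c <= g, 0 <= g & g <= 1].
Proof.
move=> h1 k1 hk c g.
have kh : k.1 - h.1 <> 0 by move/eqP; rewrite subr_eq0 => /eqP/esym.
have u1 : enorm (direction h k) = 1 := enorm_normalize kh.
have co : coordinates h.2 k.2 (direction h k) c g _ _ := angle_coordinates h1 k1 u1.
split; [|exact: c_le_g co|exact: g_ge0 co|exact: g_le1 co].
by rewrite /defect (dot_au co) (dot_bu co); ring.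
Qed.

(** Defect at most 9/5 means c g >= 1/10, whence c >= 1/10; this yields both the
contraction of the defect and the factor 21/22 for the chords. *)
Lemma average_near h k : enorm h.2 = 1 -> enorm k.2 = 1 -> h.1 <> k.1 ->
  defect h k <= 9 / 5 ->
  let e := average h k in
  [/\ average_dom h k, enorm e.2 = 1,
    [/\ h.1 <> e.1, defect h e <= 99 / 100 * defect h k &
        enorm (e.1 - h.1) <= 21 / 22 * enorm (k.1 - h.1)] &
    [/\ e.1 <> k.1, defect e k <= 99 / 100 * defect h k &
        enorm (k.1 - e.1) <= 21 / 22 * enorm (k.1 - h.1)]].
Proof.
move=> h1 k1 hk small e.
have [dE cg g0 g1] := defectE h1 k1 hk.
set c := cos _ in dE cg; set g := cos _ in dE cg g0 g1.
have cg_ge : 1 / 10 <= c * g by lra.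
have c0 : 0 <= c by nra.
have c_ge : 1 / 10 <= c by nra.
have c_gt : -1 < c by lra.
have bound m z (mE : m ^+ 2 = (1 - c ^+ 2) * (1 - g ^+ 2)) :=
  @cos_sum_near _ _ _ _ z c0 cg g1 cg_ge mE.
have := average_spec h1 k1 hk c_gt bound.
have -> : 2 - (1 + 99 * (c * g)) / 50 = 99 / 100 * defect h k by rewrite dE; field.
have l_le : 1 / 2 + 1 / (2 * (1 + c)) <= 21 / 22.
  suff : 1 / (2 * (1 + c)) <= 5 / 11 by lra.
  by rewrite ler_pdivrMr; lra.
case=> dom e1 [p1 f1 L1] [p2 f2 L2]; split=> //; split=> //.
- by rewrite (le_trans L1) // ler_wpM2r // enorm_ge0.
- by rewrite (le_trans L2) // ler_wpM2r // enorm_ge0.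
Qed.

(** Either the defect is at most 9/5 already, or the pair is in the region of
[gap_far] by [cos_pair_ge]. *)
Lemma average_initial h k : enorm h.2 = 1 -> enorm k.2 = 1 -> h.1 <> k.1 ->
  sigma h k <= 3 * pi / 4 ->
  let e := average h k in
  [/\ average_dom h k, enorm e.2 = 1,
    [/\ h.1 <> e.1, defect h e <= 9 / 5 &
        enorm (e.1 - h.1) <= 2 * enorm (k.1 - h.1)] &
    [/\ e.1 <> k.1, defect e k <= 9 / 5 &
        enorm (k.1 - e.1) <= 2 * enorm (k.1 - h.1)]].
Proof.
move=> h1 k1 hk sig e.
have L0 := enorm_ge0 (k.1 - h.1).
have [dE cg g0 g1] := defectE h1 k1 hk.
set c := cos _ in dE cg; set g := cos _ in dE cg g0 g1.
case: (lerP (defect h k) (9 / 5)) => [small|big].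
  have [dom e1 [p1 f1 L1] [p2 f2 L2]] := average_near h1 k1 hk small.
  by split=> //; split=> //; rewrite -/e in L1 L2 f1 f2 *; lra.
have cg_le : c * g <= 1 / 10 by lra.
have far : 41 / 50 <= g + 7 / 5 * c.
  apply: cos_pair_ge; have := pi_ge0 R; move: sig; rewrite /sigma.
  set t := _ + _ => sig pi0.
  have t0 : 0 <= t by rewrite addr_ge0 ?sqr_ge0.
  have : t <= (3 * pi / 4) ^+ 2.
    by rewrite -(sqr_sqrtr t0) ler_pXn2r // ?nnegrE ?sqrtr_ge0 // divr_ge0 // mulr_ge0.
  by rewrite /t; lra.
have c_gt : - (1 / 3) < c by lra.
have c_gt' : -1 < c by lra.
have g01 : 0 <= g <= 1 by rewrite g0.
have bound m z (mE : m ^+ 2 = (1 - c ^+ 2) * (1 - g ^+ 2)) :=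
  @cos_sum_far _ _ _ _ z c_gt cg g01 cg_le far mE.
have := average_spec h1 k1 hk c_gt' bound.
have -> : 2 - 1 / 5 = 9 / 5 :> R by field.
have l_le : 1 / 2 + 1 / (2 * (1 + c)) <= 2.
  suff : 1 / (2 * (1 + c)) <= 3 / 2 by lra.
  by rewrite ler_pdivrMr; lra.
case=> dom e1 [p1 f1 L1] [p2 f2 L2]; split=> //; split=> //.
- by rewrite (le_trans L1) // ler_wpM2r.
- by rewrite (le_trans L2) // ler_wpM2r.
Qed.

End Step.

(** * Limits of dyadic data with geometric decay *)

Section GeometricLimits.
Context {R : realType} {n : nat}.
Implicit Types (A B C D rho e : R).

Lemma geometric_small C rho e : 0 < rho < 1 -> 0 < e ->
  exists K : nat, forall k, (K <= k)%N -> C * rho ^+ k < e.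
Proof.
move=> /andP[r0 r1] e0.
have C1 : 0 < `|C| + 1 by rewrite ltr_wpDl.
have : `|rho| < 1 by rewrite gtr0_norm.
move=> /cvg_expr/cvgrPdist_lt/(_ (e / (`|C| + 1))).
rewrite divr_gt0 // => /(_ isT)[K _ HK]; exists K => k /HK /=.
rewrite sub0r normrN ger0_norm ?exprn_ge0 ?ltW // ltr_pdivlMr //.
have := ler_norm C; have : 0 < rho ^+ k by rewrite exprn_gt0.
by move: (rho ^+ k) => y; nra.
Qed.

(** The sequences y k - B rho^k and y k + B rho^k are monotone and enclose the
limit, which is the supremum of the first. *)
Lemma geometric_real_limit B rho (y : nat -> R) : 0 < rho < 1 ->
  (forall k, `|y k.+1 - y k| <= B * (1 - rho) * rho ^+ k) ->
  exists l, forall k, `|y k - l| <= B * rho ^+ k.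
Proof.
move=> /andP[r0 r1] step.
pose lo k := y k - B * rho ^+ k; pose up k := y k + B * rho ^+ k.
have lo_mono k m : (k <= m)%N -> lo k <= lo m.
  move=> km; rewrite -(subnK km); elim: (m - k)%N => // i /le_trans; apply.
  rewrite addSn /lo exprS; have := step (i + k)%N; rewrite ler_norml; lra.
have up_mono k m : (k <= m)%N -> up m <= up k.
  move=> km; rewrite -(subnK km); elim: (m - k)%N => // i; apply: le_trans.
  rewrite addSn /up exprS; have := step (i + k)%N; rewrite ler_norml; lra.
have B0 : 0 <= B.
  have := le_trans (normr_ge0 _) (step 0%N).
  by rewrite expr0 mulr1 pmulr_lge0 // subr_gt0.
have lo_up k m : lo k <= up m.
  apply: le_trans (lo_mono _ _ (leq_maxl k m)) _.
  apply: le_trans _ (up_mono _ _ (leq_maxr k m)).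
  by rewrite /lo /up lerD2l ge0_cp // mulr_ge0 // exprn_ge0 // ltW.
have up_ub m : ubound (range lo) (up m) by move=> _ [k _ <-].
exists (sup (range lo)) => k.
have h1 : lo k <= sup (range lo).
  by apply: ub_le_sup; [exists (up k) | exists k].
have h2 : sup (range lo) <= up k.
  by apply: ge_sup => //; exists (lo k), k.
by rewrite ler_norml; move: h1 h2; rewrite /lo /up; lra.
Qed.

Lemma geometric_limit A rho (x : nat -> 'rV[R]_n) : 0 < rho < 1 ->
  (forall k, enorm (x k.+1 - x k) <= A * rho ^+ k) ->
  exists l, forall k, enorm (x k - l) <= n%:R * (A / (1 - rho)) * rho ^+ k.
Proof.
move=> r01 step; have /andP[r0 r1] := r01.
have coord i : exists l, forall k, `|x k 0 i - l| <= A / (1 - rho) * rho ^+ k.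
  apply: geometric_real_limit => // k; rewrite divfK; last by rewrite subr_eq0 gt_eqF.
  by apply: le_trans (step k); have := ler_coord_enorm (x k.+1 - x k) i; rewrite !mxE.
have [l lP] := choice coord.
exists (\row_i l i) => k; rewrite -mulrA; apply: enorm_le_coord => i.
by rewrite !mxE.
Qed.

Lemma grid_indexP k (t : R) :
  (grid_index k t)%:~R <= 2 ^+ k * t < (grid_index k t)%:~R + 1.
Proof. by have := floor_itv (2 ^+ k * t); rewrite rmorphD. Qed.

Lemma grid_index_unique k (t : R) (j : int) :
  j%:~R <= 2 ^+ k * t < j%:~R + 1 -> grid_index k t = j.
Proof. by move=> h; apply: floor_def; rewrite rmorphD. Qed.

Lemma grid_indexS k (t : R) :
  grid_index k.+1 t = 2 * grid_index k t \/
  grid_index k.+1 t = 2 * grid_index k t + 1.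
Proof.
have := grid_indexP k t; set i := grid_index k t => h.
have [lt1|ge1] := ltrP (2 ^+ k.+1 * t) (2 * i%:~R + 1); [left|right];
  by apply: grid_index_unique; rewrite ?rmorphD rmorphM /=; move: lt1 h || move: ge1 h;
     rewrite exprS; lra.
Qed.

Lemma grid_index_dyadic k m (j : int) :
  grid_index (m + k) (j%:~R / 2 ^+ k : R) = 2 ^+ m * j.
Proof.
apply: grid_index_unique; rewrite rmorphM rmorphXn /= exprD.
have -> : 2 ^+ m * 2 ^+ k * (j%:~R / 2 ^+ k) = 2 ^+ m * j%:~R :> R.
  by field; rewrite expf_neq0.
by rewrite lexx ltrDl ltr01.
Qed.

Lemma int_eq_or_succ (i j : int) : j < i + 2 -> i < j + 1 -> j = i \/ j = i + 1.
Proof. by lia. Qed.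

Section DyadicLimit.
Variables (w : nat -> int -> 'rV[R]_n) (D rho : R).
Hypothesis rho01 : 0 < rho < 1.
Hypothesis w_interp : forall k (j : int), w k.+1 (2 * j) = w k j.
Hypothesis w_step : forall k (j : int), enorm (w k (j + 1) - w k j) <= D * rho ^+ k.

Lemma interp_iter m k j : w (m + k) (2 ^+ m * j) = w k j.
Proof. by elim: m => [|m IH]; rewrite ?mul1r // exprS -mulrA w_interp. Qed.

(** The data of all levels define one function on the dyadic numbers; the limit
is its extension, with modulus of continuity C rho^k at distance 2^-k. *)
Lemma dyadic_limit : exists (f : R -> 'rV[R]_n) C, [/\ 0 <= C,
  (forall k (t : R), enorm (w k (grid_index k t) - f t) <= C * rho ^+ k),
  (forall k j, f (j%:~R / 2 ^+ k) = w k j) &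
  (forall k t t', `|t - t'| <= 2 ^- k -> enorm (f t - f t') <= C * rho ^+ k)].
Proof.
have /andP[r0 r1] := rho01.
have D0 : 0 <= D.
  by have := le_trans (enorm_ge0 _) (w_step 0 0); rewrite expr0 mulr1.
have step (t : R) k : enorm (w k.+1 (grid_index k.+1 t) - w k (grid_index k t)) <=
    D * rho ^+ k.
  have bnd : 0 <= D * rho ^+ k by rewrite mulr_ge0 // exprn_ge0 // ltW.
  case: (grid_indexS k t) => ->; first by rewrite w_interp subrr enorm0.
  rewrite -[X in _ - X]w_interp (le_trans (w_step _ _)) // exprS mulrCA.
  by rewrite ler_piMl // ltW.
have [f fP] := choice (fun t : R => geometric_limit rho01 (step t)).
set C := _ * (D / _) in fP.
have C0 : 0 <= C by rewrite mulr_ge0 // divr_ge0 // subr_ge0 ltW.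
exists f, (2 * C + D); split.
- by rewrite addr_ge0 // mulr_ge0.
- move=> k t; rewrite (le_trans (fP t k)) // ler_wpM2r ?exprn_ge0 ?(ltW r0) //; lra.
- move=> k j; apply/esym/eqP; rewrite -subr_eq0; apply/eqP/enorm_eq0.
  apply/eqP; rewrite eq_le enorm_ge0 andbT leNgt; apply/negP => e0.
  have [K HK] := geometric_small C rho01 e0.
  have := fP (j%:~R / 2 ^+ k) (K + k)%N.
  by rewrite grid_index_dyadic interp_iter leNgt HK // leq_addr.
- move=> k.
  have close (t t' : R) : t <= t' -> t' - t <= 2 ^- k ->
      enorm (f t - f t') <= (2 * C + D) * rho ^+ k.
    move=> tt tk; set i := grid_index k t; set i' := grid_index k t'.
    have ii : i' = i \/ i' = i + 1.
      have p2 : 0 < 2 ^+ k :> R by rewrite exprn_gt0.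
      have := grid_indexP k t; have := grid_indexP k t'; rewrite -/i -/i'.
      have : 2 ^+ k * t <= 2 ^+ k * t' by rewrite ler_pM2l.
      have : 2 ^+ k * t' - 2 ^+ k * t <= 1.
        by rewrite -mulrBr mulrC -ler_pdivlMr // div1r.
      move=> h1 h2 h3 h4.
      have : (i%:~R : R) < (i' + 1)%:~R by rewrite rmorphD /=; lra.
      have : (i'%:~R : R) < (i + 2)%:~R by rewrite rmorphD /=; lra.
      by rewrite !ltr_int; exact: int_eq_or_succ.
    have wk : enorm (w k i - w k i') <= D * rho ^+ k.
      case: ii => ->; last by rewrite enormBC.
      by rewrite subrr enorm0 mulr_ge0 // exprn_ge0 // ltW.
    apply: le_trans (ler_enormB_trans (w k i) _ _) _.
    apply: le_trans (lerD (lexx _) (ler_enormB_trans (w k i') _ _)) _.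
    have := fP t k; have := fP t' k; rewrite (enormBC (f t)) -/i -/i'; lra.
  move=> t t'; have [tt|/ltW tt] := lerP t t'.
    exact: close.
  by rewrite enormBC; exact: close.
Qed.

End DyadicLimit.
End GeometricLimits.

(** * Cones around a direction *)

Section Cone.
Context {R : realType} {n : nat}.
Implicit Types (N x y : 'rV[R]_n) (e : R).

(** The convex cone of the vectors whose angle with the unit vector N has cosine
at least 1 - e. *)
Definition cone e N : set 'rV[R]_n := [set x | (1 - e) * enorm x <= dot x N].

Lemma coneD e N x y : e <= 1 -> cone e N x -> cone e N y -> cone e N (x + y).
Proof.
rewrite /cone /= => e1 cx cy; rewrite dotDl.
rewrite (le_trans _ (lerD cx cy)) // -mulrDr ler_wpM2l ?subr_ge0 //.
exact: ler_enormD.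
Qed.

Lemma cone_chords e N (P : int -> 'rV[R]_n) (i : int) (m : nat) : e <= 1 ->
  (forall j : int, i <= j < i + m%:Z -> cone e N (P (j + 1) - P j)) ->
  cone e N (P (i + m%:Z) - P i).
Proof.
move=> e1; elim: m => [|m IH] Pc.
  by rewrite addr0 subrr /cone /= enorm0 mulr0 dot0l.
have -> : P (i + m.+1%:Z) - P i =
    (P (i + m%:Z + 1) - P (i + m%:Z)) + (P (i + m%:Z) - P i).
  by rewrite addrA subrK -addrA -PoszD addn1.
apply: coneD => //; first by apply: Pc; lia.
by apply: IH => j ij; apply: Pc; lia.
Qed.

Lemma cone_of_direction e N x : enorm N = 1 -> x <> 0 ->
  enorm (normalize x - N) ^+ 2 <= 2 * e -> cone e N x.
Proof.
move=> N1 x0; rewrite sqr_enormB enorm_normalize // N1 => h.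
have xn := enorm_gt0 x0.
rewrite /cone /= -{2}(normalizeK x0) dotZl mulrC ler_pM2l //; lra.
Qed.

Lemma direction_of_cone e N x : enorm N = 1 -> x <> 0 -> cone e N x ->
  enorm (normalize x - N) ^+ 2 <= 2 * e.
Proof.
move=> N1 x0; have xn := enorm_gt0 x0.
rewrite /cone /= -{2}(normalizeK x0) dotZl mulrC ler_pM2l // => h.
by rewrite sqr_enormB enorm_normalize // N1; lra.
Qed.

Lemma cone_limit e N x C rho (y : nat -> 'rV[R]_n) K : enorm N = 1 ->
  0 <= e <= 1 -> 0 < rho < 1 ->
  (forall k, (K <= k)%N -> cone e N (y k)) ->
  (forall k, enorm (y k - x) <= C * rho ^+ k) -> cone e N x.
Proof.
move=> N1 /andP[e0 e1] rho01 yc yx; rewrite /cone /= leNgt; apply/negP => lt_x.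
have [K' HK] := geometric_small (2 * C) rho01 (ltac:(lra) :
  0 < (1 - e) * enorm x - dot x N).
have := HK _ (leq_maxr K K'); have := yc _ (leq_maxl K K'); have := yx (maxn K K').
set z := y _; rewrite /cone /=; move: (rho ^+ _) => r d c s.
have d1 : dot (z - x) N <= enorm (z - x) by have := dot_le (z - x) N; rewrite N1 mulr1.
have d2 : enorm x <= enorm z + enorm (z - x).
  by rewrite (enormBC z) -{1}(subrK z x) addrC ler_enormD.
have : (1 - e) * enorm x <= (1 - e) * enorm z + enorm (z - x).
  have := enorm_ge0 (z - x); nra.
by move: d1; rewrite !dotE; lra.
Qed.

End Cone.

(** * Convergence of points and tangents *)

Section Criterion.
Context {R : realType} {n : nat}.
Implicit Types (h : nat -> int -> 'rV[R]_n * 'rV[R]_n) (A rho e t om : R)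
  (v w x : 'rV[R]_n).

Record geometric_decay h A rho : Prop := GeometricDecay {
  decay_rate : 0 < rho < 1;
  decay_interp : forall k (j : int), h k.+1 (2 * j) = h k j;
  decay_unit : forall k j, enorm (h k j).2 = 1;
  decay_neq : forall k j, (h k j).1 <> (h k (j + 1)).1;
  decay_chord : forall k j,
    enorm ((h k (j + 1)).1 - (h k j).1) <= A * rho ^+ k;
  decay_left : forall k j,
    enorm ((h k j).2 - direction (h k j) (h k (j + 1))) <= A * rho ^+ k;
  decay_right : forall k j,
    enorm ((h k (j + 1)).2 - direction (h k j) (h k (j + 1))) <= A * rho ^+ k }.

Lemma ler_cos_dot v w x : enorm v = 1 -> enorm w = 1 -> enorm x = 1 ->
  angle v x <= angle v w -> dot v w <= dot v x.
Proof.
move=> v1 w1 x1; apply: contraTT; rewrite -!ltNge => lt_dot.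
have vw := dot_unit v1 w1; have vx := dot_unit v1 x1.
have h1 := acos_bounds vw; have h2 := acos_bounds vx.
by rewrite /angle -ltr_cos ?in_itv //= !acosK.
Qed.

(** Only the distance from v matters for convergence, and it is controlled both
on the minimal arc and at the default value v of [geodesic_point]. *)
Lemma geodesic_point_near om v w : 0 <= om <= 1 -> enorm v = 1 -> enorm w = 1 ->
  enorm (geodesic_point om v w) = 1 /\
  enorm (geodesic_point om v w - v) <= enorm (w - v).
Proof.
move=> /andP[om0 om1] v1 w1; rewrite /geodesic_point.
case: xgetP => [x _ [[x1 _] ang]|_]; last by rewrite subrr enorm0 enorm_ge0.
split=> //; rewrite -(@ler_pXn2r _ 2) ?nnegrE ?enorm_ge0 //.
rewrite !sqr_enormB v1 w1 x1 !(dotC _ v).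
suff : dot v w <= dot v x by lra.
apply: ler_cos_dot => //; rewrite ang ler_piMl //.
by have /andP[] := acos_bounds (dot_unit v1 w1).
Qed.

(** The angle is small when the chord is, as <v,w> = 1 - |v - w|^2 / 2.  The
minimum with 1 keeps the threshold inside [0, pi], where the cosine is
decreasing. *)
Lemma angle_lt e v w : 0 < e -> enorm v = 1 -> enorm w = 1 ->
  enorm (v - w) < Num.min 1 (1 - cos (Num.min e 1)) -> angle v w < e.
Proof.
move=> e0 v1 w1; rewrite lt_min => /andP[d1 d2].
have e1 : 0 < Num.min e 1 by rewrite lt_min e0 ltr01.
have e2 : Num.min e 1 <= 1 by rewrite ge_min lexx orbT.
suff : angle v w < Num.min e 1 by move/lt_le_trans; apply; rewrite ge_min lexx.
have vw := dot_unit v1 w1; have h1 := acos_bounds vw.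
have pi2 := pi_ge2 R.
have in_pi : Num.min e 1 \in `[0, pi] by rewrite in_itv /=; lra.
rewrite -ltr_cos ?in_itv //=.
rewrite /angle acosK //; have := sqr_enormB v w; rewrite v1 w1.
by have := enorm_ge0 (v - w); nra.
Qed.

Lemma decay_points h A rho (gamma : R -> 'rV[R]_n) C : geometric_decay h A rho ->
  (forall k t, enorm ((h k (grid_index k t)).1 - gamma t) <= C * rho ^+ k) ->
  points_converge h gamma.
Proof.
move=> dec gP e e0.
have [K HK] := geometric_small (C + A) (decay_rate dec) e0.
exists K => // k /= Kk t; apply: le_lt_trans (HK k Kk).
rewrite /linear_interp; set j := grid_index k t.
have om01 : 0 <= grid_weight k t <= 1.
  by rewrite /grid_weight; have := grid_indexP k t; lra.
set om := grid_weight k t in om01 *.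
have -> : (1 - om) *: (h k j).1 + om *: (h k (j + 1)).1 - gamma t =
    ((h k j).1 - gamma t) + om *: ((h k (j + 1)).1 - (h k j).1).
  by apply/rowP => i; rewrite !mxE; ring.
rewrite (le_trans (ler_enormD _ _)) // mulrDl lerD ?gP //.
have /andP[om0 om1] := om01.
by rewrite enormZ // (le_trans _ (decay_chord dec k j)) // ler_piMl ?enorm_ge0.
Qed.

Lemma tangent_step h A rho k (j : int) : geometric_decay h A rho ->
  enorm ((h k (j + 1)).2 - (h k j).2) <= 2 * A * rho ^+ k.
Proof.
move=> dec; apply: le_trans
  (ler_enormB_trans (direction (h k j) (h k (j + 1))) _ _) _.
have := decay_left dec k j; have := decay_right dec k j.
by rewrite (enormBC (h k j).2); lra.
Qed.

Lemma decay_tangents h A rho (nu : R -> 'rV[R]_n) C : geometric_decay h A rho ->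
  (forall t, enorm (nu t) = 1) ->
  (forall k t, enorm ((h k (grid_index k t)).2 - nu t) <= C * rho ^+ k) ->
  tangents_converge h nu.
Proof.
move=> dec nu1 nP.
split.
  have [K HK] := geometric_small (2 * A) (decay_rate dec) (ltr01 : 0 < (1 : R)).
  exists K => // k /= Kk j anti.
  have := le_lt_trans (tangent_step k j dec) (HK k Kk).
  rewrite anti -opprD enormN -mulr2n -scaler_nat enormZ // (decay_unit dec); lra.
move=> e e0; set b := Num.min 1 (1 - cos (Num.min e 1)).
have b0 : 0 < b.
  rewrite /b lt_min ltr01 subr_gt0 -[X in _ < X](cos0 R).
  have e1 : 0 < Num.min e 1 by rewrite lt_min e0 ltr01.
  have e2 : Num.min e 1 <= 1 by rewrite ge_min lexx orbT.
  by rewrite ltr_cos ?in_itv //=; have := pi_ge2 R; lra.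
have [K HK] := geometric_small (2 * A + C) (decay_rate dec) b0.
exists K => // k /= Kk t.
rewrite /geodesic_interp; set j := grid_index k t.
have om01 : 0 <= grid_weight k t <= 1.
  by rewrite /grid_weight; have := grid_indexP k t; lra.
have [x1 xv] := geodesic_point_near om01 (decay_unit dec k j) (decay_unit dec k (j + 1)).
apply: angle_lt => //; apply: le_lt_trans (HK k Kk).
apply: le_trans (ler_enormB_trans (h k j).2 _ _) _.
by rewrite mulrDl lerD ?nP ?(le_trans xv) ?(tangent_step _ _ dec).
Qed.

End Criterion.

(** * Tangency of the limit, and a convergence criterion *)

Section Tangency.
Context {R : realType} {n : nat}.
Implicit Types (h : nat -> int -> 'rV[R]_n * 'rV[R]_n) (A C rho e t a b : R)
  (gamma nu : R -> 'rV[R]_n).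

Lemma chord_neq0 h A rho k (j : int) : geometric_decay h A rho ->
  (h k (j + 1)).1 - (h k j).1 <> 0.
Proof.
by move=> dec /eqP; rewrite subr_eq0 => /eqP/esym; exact: (decay_neq dec).
Qed.

(** All chords of level k between a and b start at parameters close to t, so their
directions are within A rho^k of their left tangents, which are values of nu
close to nu t.  Their sum tends to the increment of gamma. *)
Lemma local_cone h A rho C gamma nu t e : geometric_decay h A rho ->
  0 <= C -> (forall t, enorm (nu t) = 1) ->
  (forall k t, enorm ((h k (grid_index k t)).1 - gamma t) <= C * rho ^+ k) ->
  (forall k j, nu (j%:~R / 2 ^+ k) = (h k j).2) ->
  (forall k t t', `|t - t'| <= 2 ^- k -> enorm (nu t - nu t') <= C * rho ^+ k) ->
  0 < e <= 1 ->
  exists2 delta, 0 < delta & forall a b, a <= b -> `|a - t| < delta ->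
    `|b - t| < delta -> cone e (nu t) (gamma b - gamma a).
Proof.
move=> dec C0 nu1 gP nuD nuM /andP[e0 e1].
have rho01 := decay_rate dec; have /andP[r0 r1] := rho01.
have [K HK] := geometric_small (A + C) rho01 e0.
have pow2 k : 0 < 2 ^+ k :> R by rewrite exprn_gt0.
(* the first chord may start 2^-k before a, hence half of 2^-K *)
exists (2 ^- K.+1); first by rewrite invr_gt0.
move=> a b ab at_ bt.
pose P k j := (h k j).1.
pose y k := P k (grid_index k b) - P k (grid_index k a).
have yx k : enorm (y k - (gamma b - gamma a)) <= 2 * C * rho ^+ k.
  have -> : y k - (gamma b - gamma a) =
    (P k (grid_index k b) - gamma b) - (P k (grid_index k a) - gamma a).
    by apply/rowP => i; rewrite /y !mxE; ring.
  rewrite (le_trans (ler_enormD _ _)) // enormN.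
  by have := gP k a; have := gP k b; rewrite /P; lra.
apply: (cone_limit (K := K.+1) (nu1 t) _ rho01 _ yx); first by rewrite ltW.
move=> k Kk; rewrite /y; set ia := grid_index k a; set ib := grid_index k b.
have iab : ia <= ib by apply: le_floor; rewrite ler_pM2l.
have [m ibE] : exists m : nat, ib = ia + m%:Z by exists `|ib - ia|%N; lia.
rewrite ibE; apply: cone_chords => // j /andP[ja jb].
apply: cone_of_direction => //; first exact: chord_neq0 dec.
have jt : `|j%:~R / 2 ^+ k - t| <= 2 ^- K.
  have := grid_indexP k a; have := grid_indexP k b; rewrite -/ia -/ib => hb ha.
  have j1 : (ia%:~R : R) <= j%:~R by rewrite ler_int.
  have j2 : (j%:~R : R) <= ib%:~R by rewrite ler_int ibE ltW.
  have q1 : j%:~R / 2 ^+ k <= b by rewrite ler_pdivrMr // mulrC; lra.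
  have q2 : a - 2 ^- k <= j%:~R / 2 ^+ k.
    by rewrite ler_pdivlMr // mulrBl mulVf ?lt0r_neq0 // mulrC; lra.
  have kK : 2 ^- k <= 2 ^- K.+1 :> R by rewrite lef_pV2 ?posrE // ler_eXn2l // ltr1n.
  have KE : 2 ^- K = 2 ^- K.+1 + 2 ^- K.+1 :> R.
    by rewrite exprS; field; rewrite lt0r_neq0.
  move: at_ bt; rewrite !ltr_norml ler_norml KE; lra.
have uN : enorm (normalize (P k (j + 1) - P k j) - nu t) <= e.
  apply: le_trans (ler_enormB_trans (h k j).2 _ _) _.
  rewrite (enormBC (normalize _)) -[X in _ + enorm (X - _)]nuD.
  have hk : A * rho ^+ k <= A * rho ^+ K.
    rewrite ler_wpM2l //.
      by have := le_trans (enorm_ge0 _) (decay_chord dec 0 0); rewrite expr0 mulr1.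
    by rewrite ler_wiXn2l ?ltW // ltnW.
  have := decay_left dec k j; have := nuM K _ _ jt; have := HK K (leqnn K).
  rewrite /direction /P; lra.
have := enorm_ge0 (normalize (P k (j + 1) - P k j) - nu t).
by rewrite /P in uN *; nra.
Qed.

(** Between a and b lies a full chord of a fine level, which is a nonzero increment
of the limit; in a cone of opening less than a right angle the remaining
increments cannot cancel it. *)
Lemma limit_injective_in_cone h A rho (gamma : R -> 'rV[R]_n) N e a b :
  geometric_decay h A rho ->
  e < 1 -> (forall k j, gamma (j%:~R / 2 ^+ k) = (h k j).1) ->
  (forall x y, a <= x -> x <= y -> y <= b -> cone e N (gamma y - gamma x)) ->
  a < b -> gamma b - gamma a <> 0.
Proof.
move=> dec e1 gD gC ab.
have half01 : 0 < (1 / 2 : R) < 1 by lra.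
have [k Hk] := geometric_small 2 half01 (ltac:(lra) : 0 < b - a).
have {Hk} := Hk k (leqnn k); rewrite expr_div_n expr1n => two_steps.
have p2 : 0 < 2 ^+ k :> R by rewrite exprn_gt0.
pose j := grid_index k a + 1.
have jP := grid_indexP k a.
pose x := j%:~R / 2 ^+ k : R; pose y := (j + 1)%:~R / 2 ^+ k : R.
have ax : a <= x by rewrite ler_pdivlMr // /j rmorphD /= mulrC; lra.
have xE : x <= a + 1 / 2 ^+ k.
  by rewrite ler_pdivrMr // mulrDl divfK ?lt0r_neq0 // /j rmorphD /= (mulrC a); lra.
have yE : y = x + 1 / 2 ^+ k by rewrite /y /x rmorphD mulrDl.
have xy : x <= y by rewrite yE lerDl divr_ge0 // ltW.
have yb : y <= b by lra.
have cy := gC x y ax xy yb.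
have cb := gC y b (le_trans ax xy) yb (lexx b).
have ca := gC a x (lexx a) ax (le_trans xy yb).
have chord : gamma y - gamma x <> 0 by rewrite !gD; exact: chord_neq0 dec.
have := enorm_gt0 chord.
move: ca cb cy; rewrite /cone /= => ca cb cy chord0 ab0.
have : dot (gamma b - gamma a) N = 0 by rewrite ab0 dot0l.
have -> : gamma b - gamma a =
    (gamma x - gamma a) + (gamma y - gamma x) + (gamma b - gamma y).
  by apply/rowP => i; rewrite !mxE; ring.
rewrite (dotDl (_ + (gamma y - _))) (dotDl (gamma x - gamma a)) => dot0.
have n1 := enorm_ge0 (gamma x - gamma a); have n2 := enorm_ge0 (gamma b - gamma y).
have e1' : 0 < 1 - e by lra.
have := mulr_gt0 e1' chord0; have := mulr_ge0 (ltW e1') n1; have := mulr_ge0 (ltW e1') n2.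
lra.
Qed.

(** Tangency: increments of gamma near t are nonzero and lie in cones around nu t
of arbitrarily small opening. *)
Theorem G1_of_geometric_decay h A rho :
  geometric_decay h A rho -> G1_convergent h.
Proof.
move=> dec; have rho01 := decay_rate dec; have /andP[r0 r1] := rho01.
have p_interp k j : (h k.+1 (2 * j)).1 = (h k j).1 by rewrite (decay_interp dec).
have v_interp k j : (h k.+1 (2 * j)).2 = (h k j).2 by rewrite (decay_interp dec).
have [gamma [Cg [Cg0 gP gD _]]] :=
  dyadic_limit rho01 p_interp (decay_chord dec).
have [nu [Cn [Cn0 nP nD nM]]] :=
  dyadic_limit rho01 v_interp (fun k j => tangent_step k j dec).
have nu1 t : enorm (nu t) = 1.
  apply/eqP; rewrite -subr_eq0 -normr_le0 leNgt; apply/negP => d0.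
  have [K HK] := geometric_small Cn rho01 d0.
  have := le_lt_trans (nP K t) (HK K (leqnn K)); apply/negP; rewrite -leNgt.
  set v := _.2; have v1 : enorm v = 1 := decay_unit dec _ _.
  have h1 := ler_enormB_trans v (nu t) 0; have h2 := ler_enormB_trans (nu t) v 0.
  move: h1 h2; rewrite !subr0 v1 (enormBC (nu t)) => h1 h2.
  by rewrite ler_norml; lra.
pose C := Cg + Cn.
have C0 : 0 <= C by rewrite addr_ge0.
have rk k : 0 <= rho ^+ k by rewrite exprn_ge0 // ltW.
have gP' k t : enorm ((h k (grid_index k t)).1 - gamma t) <= C * rho ^+ k.
  by rewrite (le_trans (gP k t)) // ler_wpM2r // lerDl.
have nM' k t t' : `|t - t'| <= 2 ^- k -> enorm (nu t - nu t') <= C * rho ^+ k.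
  by move=> /nM /le_trans; apply; rewrite ler_wpM2r // lerDr.
exists gamma, nu; split.
- exact: (decay_points dec gP).
- split=> // t; apply/cvgrPdist_lt => e e0.
  have [K HK] := geometric_small Cn rho01 e0.
  apply/nbhs_ballP; exists (2 ^- K); first by rewrite /= invr_gt0 exprn_gt0.
  move=> s ts; apply: le_lt_trans (norm_le_enorm _) _.
  by apply: le_lt_trans (nM K _ _ (ltW ts)) (HK K (leqnn K)).
- exact: (decay_tangents dec nu1 nP).
move=> t.
have side e : 0 < e -> exists2 delta, 0 < delta & forall a b, a < b ->
    `|a - t| < delta -> `|b - t| < delta -> `|nu t - normalize (gamma b - gamma a)| < e.
  (* e' < 1 keeps increments from cancelling, and 2 e' < e^2 bounds the angle *)
  move=> e0; pose e' := Num.min (1 / 2) (e ^+ 2 / 4).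
  have e'0 : 0 < e' by rewrite lt_min !divr_gt0 // exprn_gt0.
  have e'1 : e' <= 1 / 2 by rewrite ge_min lexx.
  have e'2 : e' <= e ^+ 2 / 4 by rewrite ge_min lexx orbT.
  have e'01 : 0 < e' <= 1 by lra.
  have [delta d0 near_t] := local_cone t dec C0 nu1 gP' nD nM' e'01.
  exists delta => // a b ab at_ bt.
  have ab0 : gamma b - gamma a <> 0.
    apply: (limit_injective_in_cone (N := nu t) (e := e') dec) => //; first by lra.
    move=> x y ax xy yb; apply: near_t => //;
      by move: at_ bt; rewrite !ltr_norml; lra.
  have := direction_of_cone (nu1 t) ab0 (near_t a b (ltW ab) at_ bt) => close.
  apply: le_lt_trans (norm_le_enorm _) _; rewrite enormBC.
  rewrite -(@ltr_pXn2r _ 2) ?nnegrE ?enorm_ge0 ?(ltW e0) //.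
  have e20 : 0 < e ^+ 2 by rewrite exprn_gt0.
  by apply: le_lt_trans close _; lra.
split; apply/cvgrPdist_lt => e /side[delta d0 near_t]; near=> s.
- have ts : t < s by near: s; exact: nbhs_right_gt.
  have st : s < t + delta by near: s; apply: nbhs_right_lt; rewrite ltrDl.
  by apply: near_t => //; [rewrite subrr normr0 | rewrite gtr0_norm; lra].
- have st : s < t by near: s; exact: nbhs_left_lt.
  have ts : t - delta < s by near: s; apply: nbhs_left_gt; rewrite ltrBlDr ltrDl.
  by apply: near_t => //; [rewrite ltr0_norm; lra | rewrite subrr normr0].
Unshelve. all: by end_near.
Qed.

End Tangency.

(** * The subdivision scheme *)

Section Refinement.
Context {R : realType} {n : nat}.
Implicit Types (h k : 'rV[R]_n * 'rV[R]_n) (g : int -> 'rV[R]_n * 'rV[R]_n)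
  (a b : R).

Lemma IHB_step_even g j : IHB_step g (2 * j) = g j.
Proof. by rewrite /IHB_step dvdz_mulr // mulKz. Qed.

Lemma IHB_step_odd g j : IHB_step g (2 * j + 1) = average (g j) (g (j + 1)).
Proof.
have nd : (2 %| 2 * j + 1)%Z = false by apply/negbTE/negP => /dvdzP[q]; lia.
have -> : IHB_step g (2 * j + 1) =
  let i := ((2 * j + 1) %/ 2)%Z in average (g i) (g (i + 1)).
  by rewrite /IHB_step nd.
by have -> : ((2 * j + 1) %/ 2)%Z = j by lia.
Qed.

(** Neighbours after refinement are the two ends of one half of a coarse pair. *)
Lemma IHB_stepP g (F : 'rV[R]_n * 'rV[R]_n -> 'rV[R]_n * 'rV[R]_n -> Prop) :
  (forall j, F (g j) (average (g j) (g (j + 1))) /\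
             F (average (g j) (g (j + 1))) (g (j + 1))) ->
  forall j, F (IHB_step g j) (IHB_step g (j + 1)).
Proof.
move=> Fg j.
have [i [->|->]] : exists i : int, j = 2 * i \/ j = 2 * i + 1.
  by exists (j %/ 2)%Z; lia.
  by rewrite IHB_step_even IHB_step_odd; have [] := Fg i.
rewrite IHB_step_odd (_ : 2 * i + 1 + 1 = 2 * (i + 1)); last by lia.
by rewrite IHB_step_even; have [] := Fg i.
Qed.

(** The property of neighbouring data that is propagated from level to level. *)
Record controlled a b h k : Prop := Controlled {
  unit_left : enorm h.2 = 1;
  unit_right : enorm k.2 = 1;
  distinct : h.1 <> k.1;
  defect_le : defect h k <= a;
  chord_le : enorm (k.1 - h.1) <= b }.

Lemma defect_direction h k : enorm h.2 = 1 -> enorm k.2 = 1 -> h.1 <> k.1 ->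
  enorm (h.2 - direction h k) ^+ 2 <= 2 * defect h k /\
  enorm (k.2 - direction h k) ^+ 2 <= 2 * defect h k.
Proof.
move=> h1 k1 hk.
have kh : k.1 - h.1 <> 0 by move/eqP; rewrite subr_eq0 => /eqP/esym.
have u1 : enorm (direction h k) = 1 := enorm_normalize kh.
have hu := dot_unit h1 u1; have ku := dot_unit k1 u1.
by rewrite !sqr_enormB h1 k1 u1 /defect; split; lra.
Qed.

Lemma controlled_average a b h k : controlled a b h k -> a <= 9 / 5 ->
  controlled (99 / 100 * a) (21 / 22 * b) h (average h k) /\
  controlled (99 / 100 * a) (21 / 22 * b) (average h k) k.
Proof.
case=> h1 k1 hk d l a_le.
have [_ e1 [p1 d1 l1] [p2 d2 l2]] := average_near h1 k1 hk (le_trans d a_le).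
by split; split=> //; lra.
Qed.

Lemma controlled_average_initial b h k :
  enorm h.2 = 1 -> enorm k.2 = 1 -> h.1 <> k.1 -> enorm (k.1 - h.1) <= b ->
  sigma h k <= 3 * pi / 4 ->
  controlled (9 / 5) (2 * b) h (average h k) /\
  controlled (9 / 5) (2 * b) (average h k) k.
Proof.
move=> h1 k1 hk l sig.
have [_ e1 [p1 d1 l1] [p2 d2 l2]] := average_initial h1 k1 hk sig.
by split; split=> //; lra.
Qed.

Lemma geometric_defect_le (k : nat) : 9 / 5 * (99 / 100) ^+ k <= 9 / 5 :> R.
Proof. by rewrite ler_piMr //; apply: exprn_ile1; lra. Qed.

Lemma two_powers (k : nat) : 2 * (199 / 200 : R) ^+ k <= 3 * (199 / 200) ^+ k.+1.
Proof.
have : 0 <= (199 / 200 : R) ^+ k by apply: exprn_ge0; lra.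
by rewrite exprS; lra.
Qed.

(** The rate 199/200 is at least the square root of 99/100; the factor 3 instead
of 2 absorbs the shift of the exponent. *)
Lemma sqrt_defect_decay (k : nat) (x d : R) : d <= 9 / 5 * (99 / 100) ^+ k ->
  0 <= x -> x ^+ 2 <= 2 * d -> x <= 3 * (199 / 200) ^+ k.+1.
Proof.
move=> dk x0 xd; apply: le_trans (two_powers k).
have r0 : 0 <= (199 / 200 : R) ^+ k by rewrite exprn_ge0 // divr_ge0.
rewrite -(@ler_pXn2r _ 2) ?nnegrE ?mulr_ge0 //.
apply: le_trans xd _; rewrite exprMn -exprM mulnC exprM.
have : (99 / 100 : R) ^+ k <= ((199 / 200) ^+ 2) ^+ k.
  by apply: lerXn2r; rewrite ?nnegrE; lra.
have : 0 <= ((199 / 200 : R) ^+ 2) ^+ k by rewrite exprn_ge0 // sqr_ge0.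
lra.
Qed.

Lemma chord_decay (k : nat) (B : R) : 0 <= B ->
  2 * B * (21 / 22) ^+ k <= 3 * B * (199 / 200) ^+ k.+1.
Proof.
move=> B0; have : (21 / 22 : R) ^+ k <= (199 / 200) ^+ k.
  by apply: lerXn2r; rewrite ?nnegrE; lra.
by move=> /(ler_wpM2l B0); have := ler_wpM2l B0 (two_powers k); lra.
Qed.

Section Scheme.
Variables (g0 : int -> 'rV[R]_n * 'rV[R]_n) (B : R).
Hypothesis unit0 : forall j, enorm (g0 j).2 = 1.
Hypothesis distinct0 : forall j : int, (g0 j).1 <> (g0 (j + 1)).1.
Hypothesis chord0 : forall j : int, enorm ((g0 (j + 1)).1 - (g0 j).1) <= B.
Hypothesis sigma0 : forall j : int, sigma (g0 j) (g0 (j + 1)) <= 3 * pi / 4.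

Lemma controlled_IHB (k : nat) (j : int) :
  controlled (9 / 5 * (99 / 100) ^+ k) (2 * B * (21 / 22) ^+ k)
    (IHB g0 k.+1 j) (IHB g0 k.+1 (j + 1)).
Proof.
elim: k j => [|k IH]; apply: IHB_stepP => j.
  rewrite !expr0 !mulr1.
  exact: controlled_average_initial (unit0 j) (unit0 (j + 1)) (@distinct0 j)
    (chord0 j) (sigma0 j).
rewrite !exprS [9 / 5 * _]mulrCA [2 * B * _]mulrCA.
exact: controlled_average (IH j) (geometric_defect_le k).
Qed.

Lemma IHB_defined_of_sigma : IHB_defined g0.
Proof.
case=> [|k] j.
  by have [] := average_initial (unit0 j) (unit0 (j + 1)) (@distinct0 j) (sigma0 j).
have [h1 k1 hk d l] := controlled_IHB k j.
by have [] := average_near h1 k1 hk (le_trans d (geometric_defect_le k)).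
Qed.

(** At level 0 the bounds hold since unit vectors are at distance at most 2; from
level 1 on they follow from [controlled_IHB]. *)
Lemma IHB_decay : geometric_decay (IHB g0) (3 + 3 * B) (199 / 200).
Proof.
have B0 : 0 <= B := le_trans (enorm_ge0 _) (chord0 0).
have chordS (k : nat) (j : int) := controlled_IHB k j.
have unit (k : nat) (j : int) : enorm (IHB g0 k j).2 = 1.
  by case: k => [|k]; [exact: unit0 | exact: unit_left (chordS k j)].
have neq (k : nat) (j : int) : (IHB g0 k j).1 <> (IHB g0 k (j + 1)).1.
  by case: k => [|k]; [exact: distinct0 | exact: distinct (chordS k j)].
have rho_ge0 (k : nat) : 0 <= (199 / 200 : R) ^+ k by apply: exprn_ge0; lra.
have dirs (k : nat) (j : int) :
    enorm ((IHB g0 k j).2 - direction (IHB g0 k j) (IHB g0 k (j + 1)))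
      <= 3 * (199 / 200) ^+ k /\
    enorm ((IHB g0 k (j + 1)).2 - direction (IHB g0 k j) (IHB g0 k (j + 1)))
      <= 3 * (199 / 200) ^+ k.
  have [d1 d2] := defect_direction (unit k j) (unit k (j + 1)) (neq k j).
  case: k d1 d2 => [|k] d1 d2.
    have kh : (IHB g0 0 (j + 1)).1 - (IHB g0 0 j).1 <> 0.
      by move/eqP; rewrite subr_eq0 => /eqP/esym; exact: neq.
    have u1 := enorm_normalize kh.
    have bnd v : enorm v = 1 ->
        enorm (v - direction (IHB g0 0 j) (IHB g0 0 (j + 1)))
          <= 3 * (199 / 200) ^+ 0.
      move=> v1; apply: le_trans (ler_enormD _ _) _.
      by rewrite enormN v1 /direction u1 expr0; lra.
    by split; apply: bnd; exact: unit.
  have d := defect_le (chordS k j).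
  by split; [exact: (sqrt_defect_decay d (enorm_ge0 _) d1) |
             exact: (sqrt_defect_decay d (enorm_ge0 _) d2)].
split=> //.
- by lra.
- by move=> k j; exact: IHB_step_even.
- move=> k j; apply: (@le_trans _ _ (3 * B * (199 / 200) ^+ k)); last first.
    by rewrite ler_wpM2r //; lra.
  case: k => [|k]; first by rewrite expr0 mulr1; have := chord0 j; rewrite /=; lra.
  apply: le_trans (chord_le (chordS k j)) _.
  exact: chord_decay.
- move=> k j; apply: le_trans (dirs k j).1 _; rewrite ler_wpM2r //; lra.
- move=> k j; apply: le_trans (dirs k j).2 _; rewrite ler_wpM2r //; lra.
Qed.

End Scheme.
End Refinement.

Theorem theorem3p6 (R : realType) (n : nat) (p v : int -> 'rV[R]_n) :
  (2 <= n)%N ->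
  (forall j, sphere (v j)) ->
  (forall j, p j <> p (j + 1)) ->
  (ereal_sup (range (fun j : int => (enorm (p (j + 1) - p j))%:E)) < +oo)%E ->
  (ereal_sup (range (fun j : int =>
     (sigma (p j, v j) (p (j + 1), v (j + 1)))%:E)) <= (3 * pi / 4)%:E)%E ->
  IHB_defined (fun j => (p j, v j)) /\
  G1_convergent (IHB (fun j => (p j, v j))).
Proof.
move=> _ v1 p_neq chord_sup sigma_sup.
set chord := fun j : int => (enorm (p (j + 1) - p j))%:E in chord_sup.
have chord_ub j : (chord j <= ereal_sup (range chord))%E.
  by apply: ereal_sup_ubound; exists j.
have chord_fin : ereal_sup (range chord) \is a fin_num.
  rewrite ge0_fin_numE //; apply: le_trans (chord_ub 0).
  by rewrite lee_fin enorm_ge0.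
have chord_le j : enorm (p (j + 1) - p j) <= fine (ereal_sup (range chord)).
  by rewrite -lee_fin fineK //; exact: chord_ub.
have sigma_le j : sigma (p j, v j) (p (j + 1), v (j + 1)) <= 3 * pi / 4.
  rewrite -lee_fin; apply: le_trans sigma_sup.
  by apply: ereal_sup_ubound; exists j.
pose g0 j := (p j, v j); split.
  exact: (@IHB_defined_of_sigma _ _ g0 _ v1 p_neq chord_le sigma_le).
exact: G1_of_geometric_decay
  (@IHB_decay _ _ g0 _ v1 p_neq chord_le sigma_le).
Qed.
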